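(* Fix $\beta\ge1$. Let $\{X_i\}_{i\ge1}$ be a sequence of independent random variables in a sub-linear expectation space $(\Omega,\mathscr H,\mathbb E)$ with $\mathbb E[X_i]=\mathbb E[-X_i]=0$, $\overline\sigma_i:=\sqrt{\mathbb E[X_i^2]}$, $\underline\sigma_i:=\sqrt{-\mathbb E[-X_i^2]}$, $\overline\sigma_i/\underline\sigma_i=\beta$ for all $i$, and $0<\inf_i\underline\sigma_i^2\le\sup_i\overline\sigma_i^2<\infty$. Put $S_n=\sum_{i=1}^nX_i$, $\sigma_i=(\underline\sigma_i+\overline\sigma_i)/2$, $B_n=\sqrt{\sum_{i=1}^n\sigma_i^2}$, $W_n=S_n/B_n$. Assume condition (A) below holds for $(\Omega,\mathscr H,\mathbb E)$ and $(\widetilde\Omega,\widetilde{\mathscr H},\widetilde{\mathbb E})$, and let $\alpha\in(0,1)$ be the constant from Song's theorem described in the context. If $\sup_{i\ge1}\mathbb E[|X_i|^{2+\alpha}]<\infty$, then $$\nu\Big(\lim_{n\to\infty}\frac{1}{\log n}\sum_{k\le n}\frac1k f(W_k)=\widetilde{\mathbb E}[f(\xi)]\ \text{ for every } f\in\mathcal H\Big)=1,$$ where $\xi$ is $G$-normally distributed under $\widetilde{\mathbb E}$ with $\sqrt{\widetilde{\mathbb E}[\xi^2]}=\frac{2\beta}{1+\beta}$ and $\sqrt{-\widetilde{\mathbb E}[-\xi^2]}=\frac{2}{1+\beta}$.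
   Context: Sub-linear expectation space $(\Omega,\mathscr H,\mathbb E)$: $(\Omega,\mathcal F)$ a measurable space, $\mathscr H$ a linear space of real measurable functions closed under $(X_1,\dots,X_n)\mapsto\varphi(X_1,\dots,X_n)$ for $\varphi\in C_{b,Lip}(\mathbb R^n)$ (bounded Lipschitz functions), and $\mathbb E:\mathscr H\to\mathbb R$ monotone, constant preserving, sub-additive and positively homogeneous; it is assumed $\mathbb E[X]=\sup_{P\in\mathcal P}E_P[X]$ for a family $\mathcal P$ of $\sigma$-additive probability measures, and $\nu(A)=\inf_{P\in\mathcal P}P(A)$. $(\widetilde\Omega,\widetilde{\mathscr H},\widetilde{\mathbb E})$ is another sub-linear expectation space. Independence: $Y\in\mathscr H^n$ is independent of $X\in\mathscr H^m$ if $\mathbb E[\varphi(X,Y)]=\mathbb E\big[\mathbb E[\varphi(x,Y)]|_{x=X}\big]$ for all $\varphi\in C_{b,Lip}(\mathbb R^{m+n})$ (whenever the relevant quantities are finite); $\{X_n\}$ is independent if $X_{n+1}$ is independent of $(X_1,\dots,X_n)$ for every $n$. Condition (A): for every $X\in\mathscr H$ (resp. $\widetilde{\mathscr H}$) and every sequence $f_n\in C_{b,Lip}(\mathbb R)$ with $f_n\downarrow0$, $\mathbb E[f_n(X)]\downarrow0$ (resp. $\widetilde{\mathbb E}[f_n(X)]\downarrow0$). $G$-normal distribution: $\xi$ is $G$-normal under $\widetilde{\mathbb E}$ if for each $f\in C_{b,Lip}(\mathbb R)$, $u(t,x)=\widetilde{\mathbb E}[f(x+\sqrt t\,\xi)]$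 is the unique viscosity solution of $\partial_tu-G(\partial_{xx}u)=0$ on $(0,\infty)\times\mathbb R$, $u(0,x)=f(x)$, where $G(a)=\frac12\widetilde{\mathbb E}[a\xi^2]$. $\mathcal H:=\{f\in C_{b,Lip}(\mathbb R):\widetilde{\mathbb E}[f(\xi)]=-\widetilde{\mathbb E}[-f(\xi)]\}$. Song's theorem (cited): there exist $\alpha\in(0,1)$ depending on $\beta$ and $C_{\alpha,\beta}>0$ such that for every sequence as in the claim and every $n\ge1$, $\sup_{|f|_{Lip}\le1}\big|\mathbb E[f(W_n)]-\widetilde{\mathbb E}[f(\xi)]\big|\le C_{\alpha,\beta}\sup_{1\le i\le n}\Big\{\frac{\mathbb E[|X_i|^{2+\alpha}]}{\sigma_i^{2+\alpha}}\big(\frac{\sigma_i}{B_n}\big)^{\alpha}\Big\}$, with $\xi$ as in the claim. The $\alpha$ in the claim is this constant. *)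

(* Defs.v *)
From HB Require Import structures.
From mathcomp Require Import all_boot all_order all_algebra.
From mathcomp Require Import all_classical all_reals all_analysis.
Set Implicit Arguments. Unset Strict Implicit. Unset Printing Implicit Defensive.
Import Order.TTheory GRing.Theory Num.Theory.
Import numFieldNormedType.Exports.
Local Open Scope classical_set_scope.
Local Open Scope ring_scope.

Section Defs.
Variable R : realType.

Definition bdd_lip1 (f : R -> R) : Prop :=
  (exists M : R, forall x, `|f x| <= M) /\
  (exists L : R, forall x y, `|f x - f y| <= L * `|x - y|).

(** bounded Lipschitz functions R^n -> R (l^1 norm; all norms are equivalent) *)
Definition bdd_lipn (n : nat) (phi : 'rV[R]_n -> R) : Prop :=
  (exists M : R, forall x, `|phi x| <= M) /\
  (exists L : R, forall x x',
      `|phi x - phi x'| <= L * \sum_(i < n) `|x ord0 i - x' ord0 i|).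

Definition bdd_lip_pair (n : nat) (phi : 'rV[R]_n -> R -> R) : Prop :=
  (exists M : R, forall x y, `|phi x y| <= M) /\
  (exists L : R, forall x x' y y',
      `|phi x y - phi x' y'| <=
        L * (\sum_(i < n) `|x ord0 i - x' ord0 i| + `|y - y'|)).

Record sublinear_space (d : measure_display) (T : measurableType d) := {
  sl_H : set (T -> R);
  sl_E : (T -> R) -> R;
  sl_P : set (probability T R);
  sl_Hmeas : forall X, sl_H X -> measurable_fun setT X;
  sl_Hcst : forall c : R, sl_H (fun _ => c);
  sl_Hadd : forall X Y, sl_H X -> sl_H Y -> sl_H (fun w => X w + Y w);
  sl_Hscale : forall (a : R) X, sl_H X -> sl_H (fun w => a * X w);
  sl_Hcomp : forall n (Xs : 'I_n -> T -> R) (phi : 'rV[R]_n -> R),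
      (forall i, sl_H (Xs i)) -> bdd_lipn phi ->
      sl_H (fun w => phi (\row_(i < n) Xs i w));
  sl_mono : forall X Y, sl_H X -> sl_H Y -> (forall w, X w <= Y w) ->
      sl_E X <= sl_E Y;
  sl_cst : forall c : R, sl_E (fun _ => c) = c;
  sl_subadd : forall X Y, sl_H X -> sl_H Y ->
      sl_E (fun w => X w + Y w) <= sl_E X + sl_E Y;
  sl_poshom : forall (a : R) X, 0 <= a -> sl_H X ->
      sl_E (fun w => a * X w) = a * sl_E X;
  sl_repr : forall X, sl_H X ->
      (forall P, sl_P P -> P.-integrable setT (fun w => (X w)%:E)) /\
      (sl_E X)%:E = ereal_sup [set (\int[P]_w (X w)%:E)%E | P in sl_P]
}.

Variables (d : measure_display) (T : measurableType d).

Definition lower_cap (S : sublinear_space T) (A : set T) : \bar R :=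
  ereal_inf [set P A | P in sl_P S].

Definition condA (S : sublinear_space T) : Prop :=
  forall (X : T -> R) (f : nat -> R -> R), sl_H S X ->
    (forall n, bdd_lip1 (f n)) ->
    (forall x n, f n.+1 x <= f n x) ->
    (forall x, (fun n => f n x) @ \oo --> 0) ->
    (fun n => sl_E S (fun w => f n (X w))) @ \oo --> 0.

(** {X_n} independent: X_n is independent of (X_0, ..., X_{n-1}) for every n
    (indices shifted by one w.r.t. the paper: X 0 is X_1). *)
Definition indep_seq (S : sublinear_space T) (X : nat -> T -> R) : Prop :=
  forall (n : nat) (phi : 'rV[R]_n -> R -> R), bdd_lip_pair phi ->
    sl_E S (fun w => phi (\row_(i < n) X i w) (X n w)) =
    sl_E S (fun w => sl_E S (fun w' => phi (\row_(i < n) X i w) (X n w'))).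

Definition sigma_up (S : sublinear_space T) (Y : T -> R) : R :=
  Num.sqrt (sl_E S (fun w => Y w ^+ 2)).
Definition sigma_low (S : sublinear_space T) (Y : T -> R) : R :=
  Num.sqrt (- sl_E S (fun w => - Y w ^+ 2)).
Definition sigma_mid (S : sublinear_space T) (Y : T -> R) : R :=
  (sigma_low S Y + sigma_up S Y) / 2.

Definition Bn (S : sublinear_space T) (X : nat -> T -> R) (n : nat) : R :=
  Num.sqrt (\sum_(i < n) sigma_mid S (X i) ^+ 2).

Definition Wn (S : sublinear_space T) (X : nat -> T -> R) (n : nat) (w : T) : R :=
  (\sum_(i < n) X i w) / Bn S X n.

(** The standing assumptions on the sequence (with moment exponent 2+alpha
    so that E|X_i|^{2+alpha} is meaningful). *)
Definition good_seq (S : sublinear_space T) (beta alpha : R)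
    (X : nat -> T -> R) : Prop :=
  [/\ forall i, sl_H S (X i) /\ sl_H S (fun w => X i w ^+ 2) /\
                sl_H S (fun w => `|X i w| `^ (2 + alpha)),
      indep_seq S X,
      forall i, sl_E S (X i) = 0 /\ sl_E S (fun w => - X i w) = 0,
      forall i, sigma_up S (X i) / sigma_low S (X i) = beta &
      (exists c : R, 0 < c /\ forall i, c <= sigma_low S (X i) ^+ 2) /\
      (exists C : R, forall i, sigma_up S (X i) ^+ 2 <= C)].

End Defs.

Section GNormal.
Variable R : realType.

Definition C12_test (phi phit phix phixx : R -> R -> R) : Prop :=
  [/\ forall t x, is_derive t (1 : R) (fun s => phi s x) (phit t x),
      forall t x, is_derive x (1 : R) (phi t) (phix t x),
      forall t x, is_derive x (1 : R) (phix t) (phixx t x) &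
      [/\ continuous (fun p : R * R => phi p.1 p.2),
          continuous (fun p : R * R => phit p.1 p.2),
          continuous (fun p : R * R => phix p.1 p.2) &
          continuous (fun p : R * R => phixx p.1 p.2)]].

Definition visc_sub (G : R -> R) (u : R -> R -> R) : Prop :=
  forall t x phi phit phix phixx, 0 < t -> C12_test phi phit phix phixx ->
    phi t x = u t x -> (forall s y, 0 < s -> u s y <= phi s y) ->
    phit t x - G (phixx t x) <= 0.

Definition visc_super (G : R -> R) (u : R -> R -> R) : Prop :=
  forall t x phi phit phix phixx, 0 < t -> C12_test phi phit phix phixx ->
    phi t x = u t x -> (forall s y, 0 < s -> phi s y <= u s y) ->
    0 <= phit t x - G (phixx t x).

Definition visc_solution (G : R -> R) (u : R -> R -> R) : Prop :=
  [/\ {within [set p : R * R | 0 <= p.1], continuous (fun p => u p.1 p.2)},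
      visc_sub G u & visc_super G u].

Definition poly_growth (v : R -> R -> R) : Prop :=
  exists (C : R) (k : nat), forall t x, 0 <= t -> `|v t x| <= C * (1 + `|x| ^+ k).

Variables (d : measure_display) (T : measurableType d).

Definition G_normal (S : sublinear_space R T) (xi : T -> R) : Prop :=
  sl_H S xi /\ sl_H S (fun w => xi w ^+ 2) /\
  let G := fun a : R => 2^-1 * sl_E S (fun w => a * xi w ^+ 2) in
  forall f : R -> R, bdd_lip1 f ->
    let u := fun t x => sl_E S (fun w => f (x + Num.sqrt t * xi w)) in
    visc_solution G u /\
    (forall v, visc_solution G v -> poly_growth v -> (forall x, v 0 x = f x) ->
       forall t x, 0 <= t -> v t x = u t x).

Definition calH (S : sublinear_space R T) (xi : T -> R) (f : R -> R) : Prop :=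
  bdd_lip1 f /\ sl_E S (fun w => f (xi w)) = - sl_E S (fun w => - f (xi w)).

End GNormal.

(* Main.v *)
Require Import Defs.
From HB Require Import structures.
From mathcomp Require Import all_boot all_order all_algebra.
From mathcomp Require Import all_classical all_reals all_analysis.
From mathcomp Require Import measurable_realfun.
From mathcomp Require Import ring lra zify.
Set Implicit Arguments. Unset Strict Implicit. Unset Printing Implicit Defensive.
Import Order.TTheory GRing.Theory Num.Theory.
Import numFieldNormedType.Exports.
Local Open Scope classical_set_scope.
Local Open Scope ring_scope.

(** For an arbitrary bounded Lipschitz [f] put [c = E~ f(xi)] and
    [T_n = sum_(k <= n) (f(W_k) - c) / k].  Expanding the square of the positive
    part, [(T_n^+)^2] grows at step [n] by at most [2 T_(n-1)^+ (f(W_n) - c) / n]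
    plus a summable term.  Up to a small error [T_(n-1)^+] depends on
    [X_1, ..., X_j] only, with [j] much smaller than [n], and [W_n] is close to
    [(S_n - S_j) / B_n], which is independent of them; as [T_j^+ >= 0], Song's
    theorem bounds the expectation of the product from above.  Hence
    [E (T_N^+)^2 = O((1 + ln r) r)] as soon as the harmonic sum up to [N] is at
    most [2 r].  Along [N = 2^((i+1)^3)] this makes [(T_N^+ / ln N)^2] summable
    almost surely under every [P], so [limsup T_n / ln n <= 0] there, the gaps
    being harmless because [f] is bounded.

    Every bounded Lipschitz function is approximated from above, in
    [E~ f(xi)], by members of a countable family, so the exceptional sets add up
    to a single null set.  For [f] in [calH] the upper bounds for [f] and [- f]
    coincide. *)

(** * Elementary bounds for the positive part *)

Lemma max0_dist {R : realType} (t u : R) : `|Num.max t 0 - Num.max u 0| <= `|t - u|.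
Proof.
have h1 := ler_norm (t - u); have h2 := ler_norm (u - t).
rewrite distrC in h2; rewrite ler_norml /Num.max.
by case: ltP => x0; case: ltP => y0; lra.
Qed.

(** The function [t -> (t^+)^2] has derivative [2 t^+], which is 2-Lipschitz, so its second-order
    Taylor remainder is at most [z^2]. *)
Lemma max0_sqr_step {R : realType} (t z : R) :
  (Num.max (t + z) 0) ^+ 2 <= (Num.max t 0) ^+ 2 + 2 * Num.max t 0 * z + z ^+ 2.
Proof.
rewrite /Num.max; case: ltP => tz; case: ltP => t0.
- by rewrite expr0n mulr0 mul0r !add0r sqr_ge0.
- rewrite expr0n/=; have -> : t ^+ 2 + 2 * t * z + z ^+ 2 = (t + z) ^+ 2 by ring.
  exact: sqr_ge0.
- by rewrite expr0n mulr0 mul0r !add0r; nra.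
- by rewrite le_eqVlt; apply/orP; left; apply/eqP; ring.
Qed.

(** * Monotonicity and stability of a sub-linear expectation *)

Section SublinearExpectation.
Context {R : realType} {d : measure_display} {T : measurableType d}.
Variable S : sublinear_space R T.
Local Notation E := (sl_E S).

Lemma sl_H_comp1 (Y : T -> R) (f : R -> R) :
  sl_H S Y -> bdd_lip1 f -> sl_H S (fun w => f (Y w)).
Proof.
move=> HY [[M fM] [L fL]].
have -> : (fun w => f (Y w)) =
    (fun w => (fun x : 'rV[R]_1 => f (x ord0 ord0)) (\row_(i < 1) Y w)).
  by apply/funext => w; rewrite mxE.
apply: (@sl_Hcomp _ _ _ S 1 (fun=> Y) (fun x : 'rV[R]_1 => f (x ord0 ord0))) => //.
by split; [exists M|exists L => x y; rewrite big_ord1].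
Qed.

Lemma sl_E_ge (Y : T -> R) (c : R) : sl_H S Y -> (forall w, c <= Y w) -> c <= E Y.
Proof. by move=> HY cY; rewrite -(sl_cst S c); apply: sl_mono => //; apply: sl_Hcst. Qed.

Lemma sl_E_le (Y : T -> R) (c : R) : sl_H S Y -> (forall w, Y w <= c) -> E Y <= c.
Proof. by move=> HY cY; rewrite -(sl_cst S c); apply: sl_mono => //; apply: sl_Hcst. Qed.

Lemma sl_E_leD (Y Z : T -> R) (c : R) : sl_H S Y -> sl_H S Z ->
  (forall w, Y w <= Z w + c) -> E Y <= E Z + c.
Proof.
move=> HY HZ YZ; rewrite -[in leRHS](sl_cst S c).
have Hc := sl_Hcst S c.
by apply: le_trans (sl_subadd HZ Hc); apply: sl_mono => //; apply: sl_Hadd.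
Qed.

Lemma sl_E_dist (Y Z : T -> R) (c : R) : sl_H S Y -> sl_H S Z ->
  (forall w, `|Y w - Z w| <= c) -> `|E Y - E Z| <= c.
Proof.
move=> HY HZ YZ; rewrite ler_distl; apply/andP; split.
  rewrite lerBlDr; apply: sl_E_leD => // w; have := YZ w.
  by rewrite ler_distl => /andP[+ _]; rewrite lerBlDr.
by apply: sl_E_leD => // w; have := YZ w; rewrite ler_distl => /andP[_].
Qed.

Lemma sl_E_norm (Y : T -> R) (c : R) : sl_H S Y ->
  (forall w, `|Y w| <= c) -> `|E Y| <= c.
Proof.
move=> HY Yc; rewrite ler_norml sl_E_ge ?sl_E_le// => w; have := Yc w;
by rewrite ler_norml => /andP[].
Qed.

(** Homogeneity holds for nonnegative factors only; a negative factor is moved onto [- Y], hence the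
    two mean conditions. *)
Lemma sl_E_scale0 (Y : T -> R) (a : R) : sl_H S Y ->
  E Y = 0 -> E (fun w => - Y w) = 0 -> E (fun w => a * Y w) = 0.
Proof.
move=> HY EY EnY; have [a0|a0] := leP 0 a.
  by rewrite sl_poshom// EY mulr0.
have -> : (fun w => a * Y w) = (fun w => (- a) * (- Y w)).
  by apply/funext => w; rewrite mulrNN.
have HnY : sl_H S (fun w => - Y w).
  have -> : (fun w => - Y w) = (fun w => -1 * Y w).
    by apply/funext => w; rewrite mulN1r.
  exact: sl_Hscale.
by rewrite sl_poshom ?EnY ?mulr0// oppr_ge0 ltW.
Qed.

End SublinearExpectation.

(** * Bounded Lipschitz functionals of the past *)

Section BoundedLipschitz.
Context {R : realType} {T : Type}.
Variable X : nat -> T -> R.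

Definition past (n : nat) (w : T) : 'rV[R]_n := \row_(i < n) X i w.
(** Plays the role of measurability with respect to the first [n] variables: such functionals lie in
    the expectation's domain, and independence is tested on them. *)
Definition BL (n : nat) (Y : T -> R) : Prop :=
  exists2 phi : 'rV[R]_n -> R, bdd_lipn phi & forall w, Y w = phi (past n w).

Lemma lip_const_pos (n : nat) (phi : 'rV[R]_n -> R) : bdd_lipn phi ->
  exists M L : R, [/\ 0 <= M, 0 <= L, forall x, `|phi x| <= M &
    forall x x', `|phi x - phi x'| <= L * \sum_(i < n) `|x ord0 i - x' ord0 i|].
Proof.
move=> [[M HM] [L HL]]; exists M, `|L|; split => //.
  exact: le_trans (HM 0).
by move=> x x'; apply: le_trans (HL _ _) _; rewrite ler_wpM2r ?ler_norm ?sumr_ge0.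
Qed.

Lemma BL_cst n (c : R) : BL n (fun=> c).
Proof.
exists (fun=> c) => //; split; first by exists `|c|.
by exists 0 => x x'; rewrite subrr normr0 mul0r.
Qed.

Lemma BL_add n (Y Z : T -> R) : BL n Y -> BL n Z -> BL n (fun w => Y w + Z w).
Proof.
move=> [f [[Mf fM] [Lf fL]] Yf] [g [[Mg gM] [Lg gL]] Zg].
exists (fun x => f x + g x); last by move=> w; rewrite Yf Zg.
split; first by exists (Mf + Mg) => x; rewrite (le_trans (ler_normD _ _))// lerD.
exists (Lf + Lg) => x x'; rewrite mulrDl opprD addrACA.
by rewrite (le_trans (ler_normD _ _))// lerD.
Qed.

Lemma BL_mul n (Y Z : T -> R) : BL n Y -> BL n Z -> BL n (fun w => Y w * Z w).
Proof.
move=> [f /lip_const_pos[Mf [Lf [Mf0 Lf0 fM fL]]] Yf].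
move=> [g /lip_const_pos[Mg [Lg [Mg0 Lg0 gM gL]]] Zg].
exists (fun x => f x * g x); last by move=> w; rewrite Yf Zg.
split; first by exists (Mf * Mg) => x; rewrite normrM ler_pM.
exists (Mf * Lg + Mg * Lf) => x x'.
have -> : f x * g x - f x' * g x' = f x * (g x - g x') + g x' * (f x - f x').
  by ring.
rewrite (le_trans (ler_normD _ _))// !normrM mulrDl -!mulrA.
by rewrite lerD// ler_pM.
Qed.

Lemma BL_comp n (Y : T -> R) (g : R -> R) (L : R) : BL n Y ->
  (forall x y, `|g x - g y| <= L * `|x - y|) -> BL n (fun w => g (Y w)).
Proof.
move=> [f /lip_const_pos[Mf [Lf [Mf0 Lf0 fM fL]]] Yf] gL.
have gL' x y : `|g x - g y| <= `|L| * `|x - y|.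
  by apply: le_trans (gL _ _) _; rewrite ler_wpM2r// ler_norm.
exists (fun x => g (f x)); last by move=> w; rewrite Yf.
split.
  exists (`|L| * Mf + `|g 0|) => x; rewrite -[g (f x)](subrK (g 0)).
  rewrite (le_trans (ler_normD _ _))// lerD2r (le_trans (gL' _ _))// subr0.
  by rewrite ler_wpM2l.
exists (`|L| * Lf) => x x'; rewrite (le_trans (gL' _ _))// -mulrA.
by rewrite ler_wpM2l.
Qed.

Lemma BL_pos n (Y : T -> R) : BL n Y -> BL n (fun w => Num.max (Y w) 0).
Proof.
move=> /(@BL_comp _ _ (fun y => Num.max y 0) 1); apply => x y.
by rewrite mul1r max0_dist.
Qed.

Lemma BL_sum n m (Y : nat -> T -> R) : (forall i, (i < m)%N -> BL n (Y i)) ->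
  BL n (fun w => \sum_(i < m) Y i w).
Proof.
elim: m => [_|m IH HY].
  by rewrite [X in BL n X](_ : _ = fun=> 0) ?funeqE => [|w];
    [exact: BL_cst|rewrite big_ord0].
rewrite [X in BL n X](_ : _ = fun w => \sum_(i < m) Y i w + Y m w) ?funeqE.
  by apply: BL_add; [apply: IH => i im; exact/HY/ltnW|exact: HY].
by move=> w; rewrite big_ord_recr.
Qed.

Lemma BL_le m n (Y : T -> R) : (m <= n)%N -> BL m Y -> BL n Y.
Proof.
move=> /subnKC <-; move: (n - m)%N => k {n}.
move=> [f /lip_const_pos[M [L [M0 L0 fM fL]]] Yf].
exists (fun x : 'rV[R]_(m + k) => f (lsubmx x)).
  split; first by exists M => x.
  exists L => x x'; apply: le_trans (fL _ _) _; rewrite ler_wpM2l//.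
  rewrite big_split_ord/= -[leLHS]addr0 lerD ?sumr_ge0//.
  by apply: ler_sum => i _; rewrite !mxE.
by move=> w; rewrite Yf; congr f; apply/rowP => i; rewrite !mxE.
Qed.

End BoundedLipschitz.

Lemma lip1_ge0 {R : realType} (f : R -> R) (L : R) :
  (forall x y, `|f x - f y| <= L * `|x - y|) -> 0 <= L.
Proof.
by move=> fL; have := le_trans (normr_ge0 _) (fL 1 0); rewrite subr0 normr1 mulr1.
Qed.

Lemma bdd_lip1_scale {R : realType} (f : R -> R) (b : R) :
  bdd_lip1 f -> bdd_lip1 (fun x => f (x / b)).
Proof.
move=> [[M fM] [L fL]]; split; first by exists M.
exists (L * `|b^-1|) => x y; rewrite (le_trans (fL _ _))// -mulrBl normrM.
by rewrite mulrCA mulrC mulrAC.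
Qed.

Lemma bdd_lip_pair_pos {R : realType} n (phi : 'rV[R]_n -> R -> R) :
  bdd_lip_pair phi ->
  exists M L : R, [/\ 0 <= M, 0 <= L, forall x y, `|phi x y| <= M &
    forall x x' y y', `|phi x y - phi x' y'| <=
        L * (\sum_(i < n) `|x ord0 i - x' ord0 i| + `|y - y'|)].
Proof.
move=> [[M HM] [L HL]]; exists M, `|L|; split => //; first exact: le_trans (HM 0 0).
move=> x x' y y'; apply: le_trans (HL _ _ _ _) _.
by rewrite ler_wpM2r ?ler_norm// addr_ge0 ?sumr_ge0.
Qed.

(** * Independence of a block sum from the variables before it *)

Section BlockIndependence.
Context {R : realType} {d : measure_display} {T : measurableType d}.
Variables (S : sublinear_space R T) (X : nat -> T -> R).
Hypotheses (HX : forall i, sl_H S (X i)) (indX : indep_seq S X).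
Local Notation E := (sl_E S).

Definition block_sum (j m : nat) (w : T) : R := \sum_(i < m) X (j + i)%N w.

Lemma block_sum_cat j m w : block_sum 0 (j + m) w = block_sum 0 j w + block_sum j m w.
Proof. by rewrite /block_sum big_split_ord. Qed.

Lemma BL_H n Y : BL X n Y -> sl_H S Y.
Proof.
move=> [phi bphi Yphi]; have -> : Y = fun w => phi (\row_(i < n) X i w).
  exact/funext.
exact: (@sl_Hcomp _ _ _ S n (fun i => X i)).
Qed.

Lemma sl_H_block j m : sl_H S (block_sum j m).
Proof.
elim: m => [|m IH].
  have -> : block_sum j 0 = (fun=> 0) by apply/funext => w; rewrite /block_sum big_ord0.
  exact: sl_Hcst.
have -> : block_sum j m.+1 = (fun w => block_sum j m w + X (j + m)%N w).
  by apply/funext => w; rewrite /block_sum big_ord_recr.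
exact: sl_Hadd.
Qed.

Lemma BL_block_sum j m (f : R -> R) :
  bdd_lip1 f -> BL X (j + m) (fun w => f (block_sum j m w)).
Proof.
move=> [[M fM] [L fL]].
exists (fun x : 'rV[R]_(j + m) => f (\sum_(i < m) x ord0 (rshift j i))).
  split; first by exists M.
  exists L => x x'; apply: le_trans (fL _ _) _.
  rewrite ler_wpM2l ?(lip1_ge0 fL)//.
  rewrite -sumrB big_split_ord/= -[leLHS]add0r lerD ?sumr_ge0//.
  by rewrite (le_trans (ler_norm_sum _ _ _)).
by move=> w; congr f; apply: eq_bigr => i _; rewrite mxE.
Qed.

Lemma sl_H_pair n (phi : 'rV[R]_n -> R -> R) x (Y : T -> R) :
  bdd_lip_pair phi -> sl_H S Y -> sl_H S (fun w => phi x (Y w)).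
Proof.
move=> [[M pM] [L pL]] HY; apply: (@sl_H_comp1 _ _ _ S Y (phi x)) => //.
split; first by exists M.
exists L => y y'; have := pL x x y y'; rewrite big1 ?add0r// => i _.
by rewrite subrr normr0.
Qed.

(** Integrating out one more summand preserves the class of test functions, which lets the induction
    on the block length apply to the result. *)
Lemma bdd_lip_pair_shift n (phi : 'rV[R]_n -> R -> R) (Y : T -> R) :
  bdd_lip_pair phi -> sl_H S Y ->
  bdd_lip_pair (fun x s => E (fun w => phi x (s + Y w))).
Proof.
move=> bphi HY; have [M [L [M0 L0 pM pL]]] := bdd_lip_pair_pos bphi.
have Hs s : sl_H S (fun w => s + Y w) by apply: sl_Hadd => //; exact: sl_Hcst.
have HE x s : sl_H S (fun w => phi x (s + Y w)) by exact: sl_H_pair.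
split; first by exists M => x s; apply: sl_E_norm.
exists L => x x' s s'; apply: sl_E_dist => // w.
apply: le_trans (pL _ _ _ _) _; rewrite ler_wpM2l// lerD2l.
by rewrite opprD addrACA subrr addr0.
Qed.

Lemma indep_block_last j m (phi : 'rV[R]_j -> R -> R) : bdd_lip_pair phi ->
  E (fun w => phi (past X j w) (block_sum j m.+1 w)) =
  E (fun w => E (fun w' => phi (past X j w) (block_sum j m w + X (j + m)%N w'))).
Proof.
move=> bphi; have [M [L [M0 L0 pM pL]]] := bdd_lip_pair_pos bphi.
pose Phi (x : 'rV[R]_(j + m)) y :=
  phi (lsubmx x) (\sum_(i < m) x ord0 (rshift j i) + y).
have bPhi : bdd_lip_pair Phi.
  split; first by exists M => x y; exact: pM.
  exists L => x x' y y'; apply: le_trans (pL _ _ _ _) _; rewrite ler_wpM2l//.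
  rewrite big_split_ord/= -[leRHS]addrA; apply: lerD.
    by apply: ler_sum => i _; rewrite !mxE.
  rewrite opprD addrACA (le_trans (ler_normD _ _))// lerD2r -sumrB.
  exact: ler_norm_sum.
have pastE w : lsubmx (\row_(i < j + m) X i w) = past X j w.
  by apply/rowP => i; rewrite !mxE.
have sumE w : \sum_(i < m) (\row_(i < j + m) X i w) ord0 (rshift j i) = block_sum j m w.
  by apply: eq_bigr => i _; rewrite mxE.
transitivity (E (fun w => Phi (\row_(i < j + m) X i w) (X (j + m)%N w))).
  by congr E; apply/funext => w; rewrite /Phi pastE sumE /block_sum big_ord_recr.
rewrite indX//; congr E; apply/funext => w; congr E; apply/funext => w'.
by rewrite /Phi pastE sumE.
Qed.

(** Independence is given one variable at a time. The last summand is peeled off, the induction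
    hypothesis handles the shorter block, and the last summand is then put back inside the inner
    expectation. *)
Lemma indep_block j m (phi : 'rV[R]_j -> R -> R) : bdd_lip_pair phi ->
  E (fun w => phi (past X j w) (block_sum j m w)) =
  E (fun w => E (fun w' => phi (past X j w) (block_sum j m w'))).
Proof.
elim: m phi => [|m IH] phi bphi.
  congr E; apply/funext => w.
  rewrite /block_sum (_ : (fun w' => _) = fun=> phi (past X j w) 0) ?sl_cst ?big_ord0//.
  by apply/funext => w'; rewrite big_ord0.
rewrite indep_block_last//.
rewrite (IH _ (bdd_lip_pair_shift bphi (HX (j + m)))).
congr E; apply/funext => w.
(* The peeling is used in reverse on the inner expectation, where the past is frozen and the test
   function ignores its first argument. *)
rewrite (@indep_block_last j m (fun=> phi (past X j w)))//.
have [M [L [M0 L0 pM pL]]] := bdd_lip_pair_pos bphi.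
split; first by exists M.
exists L => x x' y y'; apply: le_trans (pL _ _ _ _) _; rewrite ler_wpM2l//.
by rewrite lerD2r big1 ?sumr_ge0// => i _; rewrite subrr normr0.
Qed.

(** With the past frozen, [Y >= 0] leaves the inner expectation by positive homogeneity; the sign of
    [Y] is what lets a one-sided bound on [g] suffice. *)
Lemma indep_block_le j m (Y : T -> R) (g : R -> R) (D e : R) :
  BL X j Y -> bdd_lip1 g -> (forall w, 0 <= Y w <= D) -> 0 <= e ->
  E (fun w => g (block_sum j m w)) <= e ->
  E (fun w => Y w * g (block_sum j m w)) <= D * e.
Proof.
move=> BY bg YD e0 Ege; have [h /lip_const_pos[Mh [Lh [Mh0 Lh0 hM hL]]] Yh] := BY.
have bphi : bdd_lip_pair (fun x y => h x * g y).
  have [[M gM] [L gL]] := bg.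
  have L0 := lip1_ge0 gL.
  have M0 : 0 <= M := le_trans (normr_ge0 _) (gM 0).
  split; first by exists (Mh * M) => x y; rewrite normrM ler_pM.
  exists (Mh * L + M * Lh) => x x' y y'.
  have -> : h x * g y - h x' * g y' = h x * (g y - g y') + g y' * (h x - h x').
    by ring.
  rewrite (le_trans (ler_normD _ _))// !normrM.
  set A := \sum_(i < j) _.
  have A0 : 0 <= A by rewrite sumr_ge0.
  apply: (@le_trans _ _ (Mh * (L * `|y - y'|) + M * (Lh * A))).
    by rewrite lerD// ler_pM.
  have := mulr_ge0 (mulr_ge0 Mh0 L0) A0.
  have := mulr_ge0 (mulr_ge0 M0 Lh0) (normr_ge0 (y - y')).
  by lra.
have -> : E (fun w => Y w * g (block_sum j m w)) =
    E (fun w => E (fun w' => h (past X j w) * g (block_sum j m w'))).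
  rewrite -(@indep_block j m _ bphi); congr E; apply/funext => w.
  by rewrite Yh.
have Hg : sl_H S (fun w => g (block_sum j m w)).
  by apply: sl_H_comp1 => //; exact: sl_H_block.
have -> : (fun w => E (fun w' => h (past X j w) * g (block_sum j m w'))) =
    (fun w => Y w * E (fun w' => g (block_sum j m w'))).
  by apply/funext => w; rewrite -Yh sl_poshom//; case/andP: (YD w).
apply: sl_E_le; first by apply/(@BL_H j)/BL_mul => //; exact: BL_cst.
move=> w; have /andP[Y0 YwD] := YD w.
by apply: (@le_trans _ _ (Y w * e)); rewrite ?ler_wpM2l// ler_wpM2r.
Qed.

End BlockIndependence.

(** * The truncated square *)

Section TruncatedSquare.
Context {R : realType}.
Implicit Types (k x y : R).

(** A bounded Lipschitz substitute for [x^2], to which independence can be applied. *)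
Definition trunc_sq k x : R := (Num.min `|x| k) ^+ 2.

Lemma trunc_sq_ge0 k x : 0 <= trunc_sq k x. Proof. exact: sqr_ge0. Qed.

Lemma bdd_lip1_trunc_sq k : 0 <= k -> bdd_lip1 (trunc_sq k).
Proof.
move=> k0.
have bnd x : 0 <= Num.min `|x| k <= k by rewrite le_min normr_ge0 k0 ge_min lexx orbT.
split.
  exists (k ^+ 2) => x; have /andP[? ?] := bnd x.
  by rewrite ger0_norm ?sqr_ge0// lerXn2r.
exists (2 * k) => x y; have /andP[a0 ak] := bnd x; have /andP[b0 bk] := bnd y.
have : `|Num.min `|x| k - Num.min `|y| k| <= `|x - y|.
  have h1 := lerB_dist x y; have h2 := lerB_dist y x; rewrite distrC in h2.
  by have := normr_ge0 (x - y); rewrite ler_norml /Num.min; case: ltP => ?;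
    case: ltP => ?; lra.
rewrite /trunc_sq; move: (Num.min _ _) (Num.min _ _) a0 ak b0 bk => a b a0 ak b0 bk ab.
rewrite subr_sqr normrM mulrC ler_pM// ger0_norm; lra.
Qed.

(* Semiconcavity: this makes the second moment of truncated sums grow linearly
   although truncation destroys the martingale structure. *)
Lemma trunc_sq_semiconcave k x : 0 <= k ->
  exists a, forall y, trunc_sq k (x + y) <= trunc_sq k x + a * y + y ^+ 2.
Proof.
move=> k0; rewrite /trunc_sq.
have [xk|xk] := leP `|x| k.
  exists (2 * x) => y; rewrite [X in _ <= X + _ + _]real_normK ?num_real//.
  have -> : x ^+ 2 + 2 * x * y + y ^+ 2 = `|x + y| ^+ 2.
    by rewrite real_normK ?num_real//; ring.
  by rewrite lerXn2r ?nnegrE ?le_min ?normr_ge0 ?k0//= ge_min lexx.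
(* Beyond the truncation level the function already has its maximal value, so slope 0 works. *)
exists 0 => y; rewrite mul0r addr0 -[leLHS]addr0 lerD ?sqr_ge0//.
by rewrite lerXn2r ?nnegrE ?le_min ?normr_ge0 ?k0//= ge_min lexx orbT.
Qed.

(* AM-GM trades the truncated modulus for the truncated square. *)
Lemma lip_dist_trunc_sq (f : R -> R) (M L e x y : R) : 0 < L -> 0 < e ->
  (forall x, `|f x| <= M) -> (forall x y, `|f x - f y| <= L * `|x - y|) ->
  `|f (x + y) - f y| <= L / 2 * (e + trunc_sq (2 * M / L) x / e).
Proof.
move=> L0 e0 fM fL; rewrite /trunc_sq.
have h1 := fL (x + y) y; rewrite addrK in h1.
have h2 : `|f (x + y) - f y| <= 2 * M.
  by rewrite (le_trans (ler_normB _ _))//; have := fM (x + y); have := fM y; lra.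
have h3 : `|f (x + y) - f y| <= L * Num.min `|x| (2 * M / L).
  rewrite /Num.min; case: ifP => _ //.
  by rewrite mulrCA divff ?gt_eqF// mulr1.
move: (Num.min _ _) h3 => t h3; apply: le_trans h3 _.
(* This is [2 t <= e + t^2 / e]. *)
have : 0 <= (t - e) ^+ 2 / e by rewrite divr_ge0 ?sqr_ge0 ?ltW.
have -> : (t - e) ^+ 2 / e = e + t ^+ 2 / e - 2 * t by field; rewrite gt_eqF.
move=> h; have := mulr_ge0 (ltW L0) h; lra.
Qed.

Lemma trunc_sq_scale k b x : 0 < b -> trunc_sq k (x / b) = trunc_sq (k * b) x / b ^+ 2.
Proof.
move=> b0; rewrite /trunc_sq -expr_div_n; congr (_ ^+ 2).
by rewrite normrM normfV (gtr0_norm b0) -[k in LHS](mulfK (lt0r_neq0 b0)) minr_pMl// invr_ge0 ltW.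
Qed.

End TruncatedSquare.

(** * Second moments of partial sums and decorrelation from the past *)

Section Decorrelation.
Context {R : realType} {d : measure_display} {T : measurableType d}.
Variables (S : sublinear_space R T) (X : nat -> T -> R) (v : R).
Hypotheses (HX : forall i, sl_H S (X i)) (HX2 : forall i, sl_H S (fun w => X i w ^+ 2)).
Hypotheses (indX : indep_seq S X).
Hypotheses (EX : forall i, sl_E S (X i) = 0 /\ sl_E S (fun w => - X i w) = 0).
Hypotheses (EX2 : forall i, sl_E S (fun w => X i w ^+ 2) <= v).
Local Notation E := (sl_E S).

(** Induction on [n]: given the past, semiconcavity leaves a linear term of zero expectation and a
    square of expectation at most [v]. The bound is uniform in the truncation level. *)
Lemma trunc_sq_moment n k : 0 <= k ->
  E (fun w => trunc_sq k (block_sum X 0 n w)) <= n%:R * v.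
Proof.
move=> k0; have bk := bdd_lip1_trunc_sq k0.
have HS m : sl_H S (fun w => trunc_sq k (block_sum X 0 m w)).
  by apply: sl_H_comp1 => //; exact: sl_H_block.
elim: n => [|n IH].
  rewrite mul0r (_ : (fun=> _) = fun=> 0) ?sl_cst//; apply/funext => w.
  by rewrite /block_sum big_ord0 /trunc_sq normr0 (min_idPl k0) expr0n.
have [[M HM] [L HL]] := bk; have L0 := lip1_ge0 HL.
pose phi (x : 'rV[R]_n) y := trunc_sq k (\sum_(i < n) x ord0 i + y).
have bphi : bdd_lip_pair phi.
  split; first by exists M => x y; exact: HM.
  exists L => x x' y y'; apply: le_trans (HL _ _) _; rewrite ler_wpM2l//.
  rewrite opprD addrACA (le_trans (ler_normD _ _))// lerD2r -sumrB.
  exact: ler_norm_sum.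
have phiE w : (fun w' => phi (\row_(i < n) X i w) (X n w')) =
    (fun w' => trunc_sq k (block_sum X 0 n w + X n w')).
  apply/funext => w'; rewrite /phi; congr (trunc_sq _ (_ + _)).
  by apply: eq_bigr => i _; rewrite mxE.
have -> : E (fun w => trunc_sq k (block_sum X 0 n.+1 w)) =
    E (fun w => E (fun w' => trunc_sq k (block_sum X 0 n w + X n w'))).
  transitivity (E (fun w => phi (\row_(i < n) X i w) (X n w))).
    congr E; apply/funext => w; have /(congr1 (@^~ w)) /= -> := phiE w.
    by rewrite /block_sum big_ord_recr.
  by rewrite indX//; congr E; apply/funext => w; rewrite phiE.
have Hin s : sl_H S (fun w' => trunc_sq k (s + X n w')).
  apply: sl_H_comp1 => //; apply: sl_Hadd => //; exact: sl_Hcst.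
have step s : E (fun w' => trunc_sq k (s + X n w')) <= trunc_sq k s + v.
  have [a Ha] := trunc_sq_semiconcave s k0.
  have HaX : sl_H S (fun w => a * X n w) by exact: sl_Hscale.
  have Hc := sl_Hcst S (trunc_sq k s).
  have Hca : sl_H S (fun w => trunc_sq k s + a * X n w) by exact: sl_Hadd.
  apply: le_trans (sl_mono (Hin s) (sl_Hadd Hca (HX2 n)) (fun w => Ha _)) _.
  apply: le_trans (sl_subadd Hca (HX2 n)) _; apply: lerD => //.
  apply: le_trans (sl_subadd Hc HaX) _; rewrite sl_cst.
  by case: (EX n) => E1 E2; rewrite sl_E_scale0// addr0.
rewrite -natr1 mulrDl mul1r (le_trans _ (lerD IH (lexx v)))//.
apply: sl_E_leD => //.
have HE : BL X n (fun w => E (fun w' => trunc_sq k (block_sum X 0 n w + X n w'))).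
  exists (fun x => E (fun w' => phi x (X n w'))); last by move=> w; rewrite -phiE.
  have Hp x : sl_H S (fun w' => phi x (X n w')) by exact: Hin.
  split; first by exists M => x; apply: sl_E_norm => // w; exact: HM.
  exists L => x x'; apply: sl_E_dist => // w; apply: le_trans (HL _ _) _.
  rewrite ler_wpM2l// opprD addrACA subrr addr0 -sumrB; exact: ler_norm_sum.
exact: BL_H HE.
Qed.

(** Dropping the first [j] summands from the normalised sum makes it independent of [Y], at the
    price [Rem]. With [rho] the bound on the expectation of [Rem], this price is paid twice, whence
    [L] in place of the [L / 2] in [rho]. *)
Lemma decorrelation j m (f : R -> R) (Y : T -> R) (M L b eps c e D : R) :
  (forall x, `|f x| <= M) -> 0 < L -> (forall x y, `|f x - f y| <= L * `|x - y|) ->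
  0 < b -> 0 < eps -> BL X j Y -> (forall w, 0 <= Y w <= D) -> 0 <= e ->
  E (fun w => f (block_sum X 0 (j + m) w / b)) <= c + e ->
  E (fun w => Y w * (f (block_sum X 0 (j + m) w / b) - c)) <=
  D * (e + L * (eps + j%:R * v / b ^+ 2 / eps)).
Proof.
move=> fM L0 fL b0 eps0 BY YD e0 Efe.
have M0 : 0 <= M := le_trans (normr_ge0 _) (fM 0).
have D0 : 0 <= D.
  have w : T by exact: point.
  by have /andP[Y0 YD'] := YD w; exact: le_trans YD'.
(* The level [2 M / L] of [lip_dist_trunc_sq], rescaled because the unnormalised sum is
   truncated. *)
pose k := 2 * M / L * b.
have k0 : 0 <= k by rewrite mulr_ge0 ?divr_ge0 ?mulr_ge0// ltW.
pose Rem w := L / 2 * (eps + trunc_sq k (block_sum X 0 j w) / b ^+ 2 / eps).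
have BRem : BL X j Rem.
  apply: BL_mul; [exact: BL_cst|apply: BL_add; first exact: BL_cst].
  apply: BL_mul; [|exact: BL_cst]; apply: BL_mul; [|exact: BL_cst].
  exact: (BL_block_sum X 0 j (bdd_lip1_trunc_sq k0)).
have Rem0 w : 0 <= Rem w.
  by rewrite mulr_ge0 ?divr_ge0 ?addr_ge0 ?divr_ge0 ?trunc_sq_ge0 ?sqr_ge0// ltW.
have bf : bdd_lip1 f by split; [exists M|exists L].
have bfb := bdd_lip1_scale b bf.
pose F w := f (block_sum X 0 (j + m) w / b).
pose G w := f (block_sum X j m w / b).
have FG w : `|F w - G w| <= Rem w.
  rewrite /F /G block_sum_cat mulrDl /Rem /k -trunc_sq_scale//.
  exact: lip_dist_trunc_sq.
have BF : BL X (j + m) F by exact: (BL_block_sum X 0 (j + m) bfb).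
have BG : BL X (j + m) G by exact: (BL_block_sum X j m bfb).
have HRem := BL_H HX BRem; have HF := BL_H HX BF; have HG := BL_H HX BG.
pose rho := L / 2 * (eps + j%:R * v / b ^+ 2 / eps).
have ERem : E Rem <= rho.
  have Htr : sl_H S (fun w => trunc_sq k (block_sum X 0 j w)).
    exact/(BL_H HX)/(BL_block_sum X 0 j (bdd_lip1_trunc_sq k0)).
  pose q := L / 2 / b ^+ 2 / eps.
  have q0 : 0 <= q by rewrite !divr_ge0 ?sqr_ge0// ltW.
  have -> : Rem = (fun w => L / 2 * eps + q * trunc_sq k (block_sum X 0 j w)).
    by apply/funext => w; rewrite /Rem /q; field; rewrite !gt_eqF.
  apply: le_trans (sl_subadd (sl_Hcst _ _) (sl_Hscale _ Htr)) _.
  rewrite sl_cst sl_poshom// /rho.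
  have -> : L / 2 * (eps + j%:R * v / b ^+ 2 / eps) = L / 2 * eps + q * (j%:R * v).
    by rewrite /q; field; rewrite !gt_eqF.
  by rewrite lerD2l ler_wpM2l// trunc_sq_moment.
have rho0 : 0 <= rho by apply: le_trans ERem; apply: sl_E_ge.
have bg : bdd_lip1 (fun x => f (x / b) - c).
  have [[M' HM'] [L' HL']] := bfb; split.
    by exists (M' + `|c|) => x; rewrite (le_trans (ler_normB _ _))// lerD.
  exists L' => x y.
  by have -> : f (x / b) - c - (f (y / b) - c) = f (x / b) - f (y / b) by ring.
(* First payment: the upper bound on the expectation is transferred from the full sum to the
   block. *)
have EG : E (fun w => G w - c) <= e + rho.
  apply: (@le_trans _ _ (E F + E Rem - c)).
    have HFR := sl_Hadd HF HRem.
    apply: (@le_trans _ _ (E (fun w => F w + Rem w) - c)); last first.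
      by rewrite lerD2r sl_subadd.
    apply: sl_E_leD => //; first exact: sl_Hadd HG (sl_Hcst _ _).
    by move=> w; rewrite lerD2r; have := FG w; rewrite ler_distl; lra.
  by move: Efe ERem; rewrite -/F; lra.
have EYG := indep_block_le HX indX BY bg YD (addr_ge0 e0 rho0) EG.
have BYj := BL_le (leq_addr m j) BY.
have BYG : BL X (j + m) (fun w => Y w * (G w - c)).
  by apply: BL_mul => //; apply: BL_add => //; exact: BL_cst.
have BYF : BL X (j + m) (fun w => Y w * (F w - c)).
  by apply: BL_mul => //; apply: BL_add => //; exact: BL_cst.
have HDR := sl_Hscale D HRem; have HYG := BL_H HX BYG.
(* Second payment: the full sum is replaced by the block inside the product. *)
apply: (@le_trans _ _ (E (fun w => Y w * (G w - c) + D * Rem w))).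
  apply: sl_mono; [exact: BL_H BYF|exact: sl_Hadd|move=> w].
  have /andP[Y0 YwD] := YD w.
  have h : F w - c <= G w - c + Rem w by have := FG w; rewrite ler_distl; lra.
  apply: (le_trans (ler_wpM2l Y0 h)); rewrite mulrDr lerD2l ler_wpM2r//.
apply: le_trans (sl_subadd HYG HDR) _.
rewrite sl_poshom//; have := ler_wpM2l D0 ERem.
move: EYG; rewrite /G /rho /=; lra.
Qed.

End Decorrelation.

(** * Harmonic sums and the logarithm *)

Section Harmonic.
Context {R : realType}.

Definition harm (n : nat) : R := \sum_(i < n) i.+1%:R^-1.

Lemma harm0 : harm 0 = 0. Proof. by rewrite /harm big_ord0. Qed.

Lemma harmS n : harm n.+1 = harm n + n.+1%:R^-1.
Proof. by rewrite /harm big_ord_recr. Qed.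

Lemma harm_ge0 n : 0 <= harm n.
Proof. by apply: sumr_ge0 => i _; rewrite invr_ge0. Qed.

Lemma le_harm : {homo harm : m n / (m <= n)%N >-> m <= n}.
Proof.
by move=> m n /subnKC <-; rewrite /harm big_split_ord/= lerDl sumr_ge0// => i _;
  rewrite invr_ge0.
Qed.

Lemma invS_le_ln n : (0 < n)%N -> n.+1%:R^-1 <= ln n.+1%:R - ln n%:R :> R.
Proof.
move=> n0; have n0' : 0 < n%:R :> R by rewrite ltr0n.
rewrite -opprB lerNr -ln_div ?posrE//.
have -> : n%:R / n.+1%:R = 1 + - n.+1%:R^-1 :> R.
  by rewrite -natr1; field; rewrite natr1 pnatr_eq0.
by apply: le_ln1Dx; rewrite ltrN2 invf_lt1// ltr1n.
Qed.

Lemma ln_le_invn n : (0 < n)%N -> ln n.+1%:R - ln n%:R <= n%:R^-1 :> R.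
Proof.
move=> n0; have n0' : 0 < n%:R :> R by rewrite ltr0n.
rewrite -ln_div ?posrE//.
have -> : n.+1%:R / n%:R = 1 + n%:R^-1 :> R by rewrite -natr1; field; rewrite gt_eqF.
by apply: le_ln1Dx; apply: (@lt_trans _ _ 0); rewrite ?invr_gt0// ltrN10.
Qed.

(** The first term is at most 1, and the later ones are compared with the integral of [1/x] from
    [j + 1] to [n]. *)
Lemma harm_block_ln j n : (j < n)%N -> harm n - harm j <= 1 + ln n%:R - ln j.+1%:R.
Proof.
elim: n => // n IH; rewrite ltnS leq_eqVlt => /orP[/eqP <-|jn].
  by rewrite harmS addrAC subrr add0r addrK invf_le1// ler1n.
rewrite harmS; have := IH jn; have := @invS_le_ln n (leq_trans (ltn0Sn j) jn).
move: (ln _) (ln _) (ln _) (n.+1%:R^-1) => *; lra.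
Qed.

Lemma harm_block j n q : (j <= n)%N -> (0 < q)%N -> (n <= q * j.+1)%N ->
  harm n - harm j <= 1 + ln q%:R.
Proof.
rewrite leq_eqVlt => /orP[/eqP <-|jn] q0 nq.
  by rewrite subrr addr_ge0// ln_ge0// ler1n.
apply: le_trans (harm_block_ln jn) _; rewrite -addrA lerD2l lerBlDr -lnM ?posrE ?ltr0n//.
by rewrite -natrM ler_ln ?posrE ?ltr0n ?ler_nat// ?muln_gt0 ?q0// (leq_trans _ jn).
Qed.

Lemma harm_le_ln n : (0 < n)%N -> harm n <= 1 + ln n%:R.
Proof. by move=> n0; have := harm_block_ln n0; rewrite harm0 ln1 !subr0. Qed.

Lemma ln_le_harm n : (0 < n)%N -> ln n%:R <= harm n.
Proof.
case: n => // n _; apply: (@le_trans _ _ (harm n)); last exact: le_harm.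
elim: n => [|n IH]; first by rewrite ln1 harm_ge0.
rewrite harmS; have := @ln_le_invn n.+1 isT.
move: IH; move: (ln _) (ln _) (n.+1%:R^-1) => *; lra.
Qed.

End Harmonic.

(** * Almost sure convergence from summable expectations *)

Section AlmostSureSummability.
Context {R : realType} {d : measure_display} {T : measurableType d}.
Variable V : nat -> T -> R.
Hypotheses (V0 : forall i w, 0 <= V i w) (mV : forall i, measurable_fun setT (V i)).

Definition summable_set : set T :=
  [set w | (\sum_(0 <= i <oo) (V i w)%:E < +oo)%E].

Let mVE i : measurable_fun setT (fun w => (V i w)%:E).
Proof. exact/measurable_EFinP. Qed.

Let mseries : measurable_fun setT (fun w => \sum_(0 <= i <oo) (V i w)%:E)%E.
Proof. by apply: ge0_emeasurable_sum => // i w _ _; rewrite lee_fin. Qed.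

Lemma measurable_summable_set : measurable summable_set.
Proof.
rewrite -[summable_set]setTI; exact: emeasurable_fun_infty_o.
Qed.

Lemma summable_set_cvg0 w : summable_set w -> V ^~ w @ \oo --> 0.
Proof.
move=> Aw; apply: cvg_series_cvg_0; apply: nondecreasing_is_cvgn.
  by apply: nondecreasing_series => i _ _; exact: V0.
exists (fine (\sum_(0 <= i <oo) (V i w)%:E)%E) => _ [n _ <-].
rewrite -lee_fin fineK; last first.
  rewrite ge0_fin_numE//; apply: nneseries_ge0 => i _ _; rewrite lee_fin; exact: V0.
rewrite /series/= -sumEFin; apply: nneseries_lim_ge => i _ _; rewrite lee_fin; exact: V0.
Qed.

(** By monotone convergence the series has a finite integral, hence is finite almost surely. *)
Lemma probability_summable_set (P : probability T R) (a : nat -> R) (C : R) :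
  (forall i, \int[P]_w (V i w)%:E <= (a i)%:E)%E ->
  (forall n, \sum_(0 <= i < n) a i <= C) -> P summable_set = 1%E.
Proof.
move=> Va aC.
have intV : P.-integrable setT (fun w => \sum_(0 <= i <oo) (V i w)%:E)%E.
  apply/integrableP; split => //.
  rewrite (eq_integral (fun w => \sum_(0 <= i <oo) (V i w)%:E)%E); last first.
    move=> w _; rewrite gee0_abs//; apply: nneseries_ge0 => i _ _.
    by rewrite lee_fin.
  rewrite integral_nneseries//; last by move=> i w _; rewrite lee_fin.
  apply: (@le_lt_trans _ _ C%:E); last exact: ltry.
  apply: lime_le.
    by apply: is_cvg_nneseries => i _ _; apply: integral_ge0 => w _; rewrite lee_fin.
  near=> n; apply: (@le_trans _ _ (\sum_(0 <= i < n) (a i)%:E)%E).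
    by apply: lee_sum => i _; exact: Va.
  by rewrite sumEFin lee_fin.
have mA := measurable_summable_set.
have PC0 : P (~` summable_set) = 0%E.
  apply/negligibleP; first exact: measurableC.
  have := integrable_ae measurableT intV; apply: negligibleS => w/= nA fw.
  by apply: nA; rewrite /summable_set/= ltey_eq fw.
have := probability_setC P (measurableC mA).
by rewrite setCK PC0 sube0.
Unshelve. all: by end_near.
Qed.

End AlmostSureSummability.

(** * A subsequence along which the logarithm grows like a cube *)

Section LogarithmicSubsequence.
Context {R : realType}.

(** The logarithm is of order [(i+1)^3]. Hence a second moment of order [r (1 + ln r)] with
    [r = (i+1)^3], divided by [r^2], is summable, while the harmonic weight between consecutive
    indices, of order [(i+1)^2], is negligible. *)
Definition sub_idx (i : nat) : nat := (2 ^ (i.+1 ^ 3))%N.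

Lemma sub_idx_gt0 i : (0 < sub_idx i)%N. Proof. by rewrite expn_gt0. Qed.

Lemma ln2_gt0 : 0 < ln 2 :> R. Proof. by rewrite ln_gt0// ltr1n. Qed.

Lemma ln2_le1 : ln 2 <= 1 :> R.
Proof. by rewrite -[X in ln X]/(1 + 1) le_ln1Dx// (lt_trans _ (@ltr01 R))// ltrN10. Qed.

Lemma ln_sub_idx i : ln (sub_idx i)%:R = (i.+1 ^ 3)%:R * ln 2 :> R.
Proof. by rewrite /sub_idx natrX lnXn// mulr_natl. Qed.

Lemma harm_sub_idx i : harm (sub_idx i) <= 2 * (i.+1 ^ 3)%:R :> R.
Proof.
apply: le_trans (harm_le_ln (sub_idx_gt0 i)) _; rewrite ln_sub_idx.
have h : 1 <= (i.+1 ^ 3)%:R :> R by rewrite ler1n expn_gt0.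
have := ln2_le1; have := ln2_gt0; nra.
Qed.

Lemma ln_cube i : 1 + ln (i.+1 ^ 3)%:R <= 3 * i.+1%:R :> R.
Proof.
have h : ln (i%:R + 1) <= i%:R :> R.
  by rewrite addrC le_ln1Dx// (lt_le_trans (@ltrN10 R)).
have i0 : 0 < i%:R + 1 :> R by rewrite natr1.
by rewrite natrX -natr1 lnXn// -[_ *+ 3]mulr_natl; lra.
Qed.

Lemma sub_idx_bracket I n : (sub_idx I <= n)%N ->
  exists i, [/\ (I <= i)%N, (sub_idx i <= n)%N & (n < sub_idx i.+1)%N].
Proof.
move=> In; have ub i : (sub_idx i <= n)%N -> (i <= n)%N.
  apply: leq_trans; rewrite /sub_idx ltnW// (leq_trans (ltn_expl _ (isT : (1 < 2)%N)))//.
  by rewrite leq_exp2l// ltnW// -[X in (X <= _)%N]expn1 leq_pexp2l.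
have exI : exists i, (sub_idx i <= n)%N by exists I.
case: (ex_maxnP exI ub) => i iN imax; exists i; split => //; first exact: imax.
by rewrite ltnNge; apply/negP => /imax; rewrite ltnn.
Qed.

Lemma sub_idx_gap i n : (sub_idx i <= n)%N -> (n < sub_idx i.+1)%N ->
  harm n - harm (sub_idx i) <= 8 * i.+1%:R ^+ 2 :> R.
Proof.
(* [m] is the difference of the consecutive cubes, so [2^m] is the ratio of consecutive indices. *)
move=> iN Ni; pose m := (3 * i ^ 2 + 9 * i + 7)%N.
have E3 : (i.+2 ^ 3 = i.+1 ^ 3 + m)%N by rewrite /m; ring.
apply: (@le_trans _ _ (1 + ln (2 ^ m)%:R)).
  apply: harm_block => //; first by rewrite expn_gt0.
  by rewrite ltnW// (leq_trans Ni)// /sub_idx E3 expnD mulnC leq_mul.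
rewrite natrX lnXn// -[_ *+ m]mulr_natl.
have mm : m%:R <= 7 * i.+1%:R ^+ 2 :> R.
  by rewrite -natrX -natrM ler_nat /m; nia.
have i1 : 1 <= i.+1%:R ^+ 2 :> R by rewrite -natrX ler1n expn_gt0.
have := ler_wpM2l (ler0n R m) ln2_le1; lra.
Qed.

(** The sixth power is the squared order of the logarithm at [sub_idx i]. Between two indices [t]
    moves by at most its harmonic weight, which is of lower order. *)
Lemma log_sum_little (t : nat -> R) (C : R) : 0 <= C ->
  (forall j n, (j <= n)%N -> `|t n - t j| <= C * (harm n - harm j)) ->
  (fun i => (Num.max (t (sub_idx i)) 0) ^+ 2 / i.+1%:R ^+ 6) @ \oo --> 0 ->
  forall eps : R, 0 < eps -> \forall n \near \oo, t n <= eps * ln n%:R.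
Proof.
move=> C0 tC t0 eps eps0; have l0 := ln2_gt0.
(* Two errors of size [del (i+1)^3], at the index and across the gap, add up to [eps] times the
   logarithm of [sub_idx i]. *)
pose del := eps * ln 2 / 2.
have del0 : 0 < del by rewrite divr_gt0// mulr_gt0.
have : \forall i \near \oo, (Num.max (t (sub_idx i)) 0) ^+ 2 / i.+1%:R ^+ 6 <= del ^+ 2.
  have /cvgrPdist_le/(_ (del ^+ 2)) := t0; rewrite exprn_gt0// => /(_ isT).
  apply: filterS => i; rewrite sub0r normrN ger0_norm//.
  by rewrite divr_ge0 ?sqr_ge0// exprn_ge0.
move=> [I1 _ HI1].
have [I2 HI2] : exists I2 : nat, 8 * C / del <= I2%:R.
  by exists (Num.truncn (8 * C / del)).+1; exact/ltW/truncnS_gt.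
exists (sub_idx (maxn I1 I2)) => // n /= /sub_idx_bracket[i [Ii iN Ni]].
move: Ii; rewrite geq_max => /andP[I1i I2i].
have i0 : 0 < i.+1%:R :> R by [].
set c := i.+1%:R ^+ 3 : R.
have h1 : Num.max (t (sub_idx i)) 0 <= del * c.
  have := HI1 i I1i; rewrite /= ler_pdivrMr ?exprn_gt0// => h.
  have dc0 : 0 <= del * c by rewrite mulr_ge0 ?exprn_ge0 ?(ltW del0).
  rewrite -ler_sqr ?nnegrE// ?le_max ?lexx ?orbT//.
  by have -> : (del * c) ^+ 2 = del ^+ 2 * i.+1%:R ^+ 6 by rewrite /c; ring.
have h2 : t n - t (sub_idx i) <= C * (8 * i.+1%:R ^+ 2).
  apply: le_trans (ler_norm _) _; apply: le_trans (tC _ _ iN) _.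
  by rewrite ler_wpM2l// sub_idx_gap.
have h3 : C * (8 * i.+1%:R ^+ 2) <= del * c.
  have : 8 * C <= del * i.+1%:R.
    rewrite [leRHS]mulrC -ler_pdivrMr//; apply: le_trans HI2 _; rewrite ler_nat.
    exact: leq_trans I2i (leqnSn i).
  move=> /(ler_wpM2r (sqr_ge0 (i.+1%:R : R))); rewrite /c; lra.
have h4 : t (sub_idx i) <= Num.max (t (sub_idx i)) 0 by rewrite le_max lexx.
have h5 : eps * ln (sub_idx i)%:R <= eps * ln n%:R.
  rewrite ler_pM2l// ler_ln ?posrE ?ltr0n ?ler_nat ?sub_idx_gt0//.
  exact: leq_trans (sub_idx_gt0 i) iN.
apply: le_trans h5; rewrite ln_sub_idx natrX -/c.
have -> : eps * (c * ln 2) = 2 * (del * c) by rewrite /del; field.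
lra.
Qed.

Lemma sum_inv_sq n : \sum_(0 <= i < n) (i.+1%:R ^+ 2)^-1 <= 2 :> R.
Proof.
case: n => [|n]; first by rewrite big_nil.
(* The strengthened bound is inductive because [1/(k+1)^2 <= 1/k - 1/(k+1)]. *)
suff h : \sum_(0 <= i < n.+1) (i.+1%:R ^+ 2)^-1 <= 2 - n.+1%:R^-1 :> R.
  by apply: le_trans h _; rewrite gerBl invr_ge0.
elim: n => [|n IH]; first by rewrite big_nat1 expr1n invr1; lra.
rewrite big_nat_recr//=; apply: le_trans (lerD IH (lexx _)) _.
have n0 : 0 < n.+1%:R :> R by [].
rewrite -[n.+2%:R]natr1; move: n.+1%:R n0 => x x0.
rewrite -subr_ge0.
have -> : 2 - (x + 1)^-1 - (2 - x^-1 + ((x + 1) ^+ 2)^-1) = (x * (x + 1) ^+ 2)^-1.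
  by field; rewrite !gt_eqF ?addr_gt0.
by rewrite invr_ge0 mulr_ge0 ?sqr_ge0// ltW.
Qed.

End LogarithmicSubsequence.

(** * Second moment of the positive part and the almost sure upper bound *)

Section SecondMoment.
Context {R : realType} {d : measure_display} {T : measurableType d}.
Variables (S : sublinear_space R T) (X : nat -> T -> R) (v : R).
Hypotheses (HX : forall i, sl_H S (X i)) (HX2 : forall i, sl_H S (fun w => X i w ^+ 2)).
Hypotheses (indX : indep_seq S X).
Hypotheses (EX : forall i, sl_E S (X i) = 0 /\ sl_E S (fun w => - X i w) = 0).
Hypotheses (EX2 : forall i, sl_E S (fun w => X i w ^+ 2) <= v).
Variables (b : nat -> R) (s : R).
Hypotheses (s0 : 0 < s) (b0 : forall n, 0 < b n.+1).
Hypothesis (bs : forall n, s * n.+1%:R <= b n.+1 ^+ 2).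
Variables (f : R -> R) (M L c : R) (e : nat -> R) (Q : R).
Hypotheses (fM : forall x, `|f x| <= M) (cM : `|c| <= M).
Hypotheses (L0 : 0 < L) (fL : forall x y, `|f x - f y| <= L * `|x - y|).
Hypothesis (e0 : forall n, 0 <= e n).
Hypothesis (Efe : forall n,
  sl_E S (fun w => f (block_sum X 0 n.+1 w / b n.+1)) <= c + e n).
Hypothesis (eQ : forall n, harm n * e n <= Q).
Local Notation E := (sl_E S).

(** Indices are shifted: [incr n] belongs to the sum of the first [n + 1] variables and enters
    [log_sum] with weight [1/(n+1)]. *)
Definition incr (n : nat) (w : T) : R := f (block_sum X 0 n.+1 w / b n.+1) - c.
Definition log_sum (n : nat) (w : T) : R := \sum_(k < n) incr k w / k.+1%:R.
Definition pos_sq (n : nat) (w : T) : R := (Num.max (log_sum n w) 0) ^+ 2.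

Lemma log_sumS n w : log_sum n.+1 w = log_sum n w + incr n w / n.+1%:R.
Proof. by rewrite /log_sum big_ord_recr. Qed.

Lemma incr_bound n w : `|incr n w| <= 2 * M.
Proof.
rewrite /incr (le_trans (ler_normB _ _))//.
by have := fM (block_sum X 0 n.+1 w / b n.+1); have := cM; lra.
Qed.

Lemma bound_ge0 : 0 <= M. Proof. exact: le_trans (fM 0). Qed.

Lemma log_sum_dist j n w : (j <= n)%N ->
  `|log_sum n w - log_sum j w| <= 2 * M * (harm n - harm j).
Proof.
move=> /subnKC <-; elim: (n - j)%N => [|m IH].
  by rewrite addn0 !subrr normr0 mulr0.
rewrite addnS log_sumS harmS addrAC (le_trans (ler_normD _ _))//.
rewrite [_ + _ - harm j]addrAC mulrDr lerD// normrM ler_pM ?incr_bound//.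
by rewrite ger0_norm// invr_ge0.
Qed.

Lemma BL_incr n : BL X n.+1 (incr n).
Proof.
apply: BL_add; last exact: BL_cst.
apply: (BL_block_sum X 0 n.+1 (f := fun x => f (x / b n.+1))).
by apply: bdd_lip1_scale; split; [exists M|exists L].
Qed.

Lemma BL_log_sum n : BL X n (log_sum n).
Proof.
apply: (@BL_sum _ _ _ _ _ (fun k w => incr k w / k.+1%:R)) => i im.
by apply: BL_mul; [apply: BL_le (BL_incr i)|exact: BL_cst].
Qed.

Lemma BL_pos_sq n : BL X n (pos_sq n).
Proof. by apply: BL_mul; exact/BL_pos/BL_log_sum. Qed.

(* Split the past at [j = n %/ r^2]: before [j] it is almost independent of the
   [n]-th increment, after [j] it has harmonic weight [O(1 + ln r)]. *)
Lemma pos_sq_moment_step n r : (0 < r)%N -> harm n <= 2 * r%:R :> R ->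
  E (pos_sq n.+1) <= E (pos_sq n) + n.+1%:R^-1 *
    ((4 * M * Q + 8 * M * L * (1 + v / s) + 12 * M ^+ 2) + 16 * M ^+ 2 * ln (r%:R : R)).
Proof.
move=> r0 hr; have M0 := bound_ge0.
(* Decorrelation is used with [eps = 1/r]. Since [j <= n / r^2], both of its error terms are
   [O(1/r)], which compensates the bound [2 M harm j <= 4 M r] on [Y]. *)
pose q := (r ^ 2)%N; pose j := (n %/ q)%N.
have q0 : (0 < q)%N by rewrite expn_gt0 r0.
have jn : (j <= n)%N by exact: leq_div.
have hblock : harm n - harm j <= 1 + 2 * ln r%:R :> R.
  apply: le_trans (harm_block jn q0 _) _.
    by rewrite mulnC ltnW// ltn_ceil.
  by rewrite natrX lnXn ?ltr0n// mulr2n mulr_natl mulr2n.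
have v0 : 0 <= v by apply: le_trans (EX2 0); apply: sl_E_ge => // w; exact: sqr_ge0.
pose Y w := Num.max (log_sum j w) 0.
have BY : BL X j Y by exact/BL_pos/BL_log_sum.
have YD w : 0 <= Y w <= 2 * M * harm j.
  rewrite le_max lexx orbT/= ge_max mulr_ge0 ?harm_ge0 ?mulr_ge0// andbT.
  have := @log_sum_dist 0 j w (leq0n j); rewrite harm0 subr0 /log_sum big_ord0 subr0.
  exact: le_trans (ler_norm _).
have rp : 0 < r%:R :> R by rewrite ltr0n.
have EYZ : E (fun w => Y w * incr n w) <= 2 * M * Q + 4 * M * L * (1 + v / s).
  have := @decorrelation _ _ _ S X v HX HX2 indX EX EX2 j (n.+1 - j) f Y M L (b n.+1)
    (r%:R^-1) c (e n) (2 * M * harm j) fM L0 fL (b0 n) _ BY YD (e0 n).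
  rewrite subnKC ?(leq_trans jn)//; move=> /(_ _ (Efe n)); rewrite invr_gt0 => /(_ rp).
  move=> /le_trans; apply.
  have hj : harm j <= harm n :> R by exact: le_harm.
  have hj0 : 0 <= harm j :> R by exact: harm_ge0.
  rewrite mulrDr; apply: lerD.
    rewrite -mulrA ler_wpM2l ?mulr_ge0//; apply: le_trans (eQ n).
    by rewrite ler_wpM2r.
  have key : j%:R * v / b n.+1 ^+ 2 / r%:R^-1 <= v / s / r%:R.
    have bb : 0 < b n.+1 ^+ 2 by rewrite exprn_gt0.
    have jr : j%:R * r%:R ^+ 2 <= n.+1%:R :> R.
      by rewrite -natrX -natrM ler_nat (leq_trans (leq_trunc_div _ _)).
    have js : j%:R * r%:R ^+ 2 * s / b n.+1 ^+ 2 <= 1.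
      rewrite ler_pdivrMr// mul1r; apply: le_trans (bs n).
      by rewrite mulrC ler_pM2l.
    have -> : j%:R * v / b n.+1 ^+ 2 / r%:R^-1 =
        v / s / r%:R * (j%:R * r%:R ^+ 2 * s / b n.+1 ^+ 2).
      by field; rewrite !gt_eqF.
    by rewrite ler_piMr// !divr_ge0// ltW.
  have vs0 : 0 <= v / s by rewrite divr_ge0// ltW.
  have hjr : harm j / r%:R <= 2 :> R.
    by rewrite ler_pdivrMr//; exact: le_trans hr.
  apply: (@le_trans _ _ (2 * M * harm j * (L * (r%:R^-1 + v / s / r%:R)))).
    rewrite ler_wpM2l ?mulr_ge0// ler_wpM2l ?lerD2l// ltW//.
  have -> : 2 * M * harm j * (L * (r%:R^-1 + v / s / r%:R)) =
      2 * M * L * (1 + v / s) * (harm j / r%:R) by field; rewrite !gt_eqF.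
  have -> : 4 * M * L * (1 + v / s) = 2 * M * L * (1 + v / s) * 2 by ring.
  by rewrite ler_wpM2l// !mulr_ge0 ?addr_ge0// ltW.
pose h := 1 + 2 * ln r%:R :> R.
pose i := n.+1%:R^-1 : R.
have i0 : 0 <= i by rewrite invr_ge0.
have i1 : i <= 1 by rewrite invf_le1// ler1n.
(* In the linear term the positive part at [n] is replaced by [Y], at a cost governed by the
   harmonic weight between [j] and [n]; in the quadratic term [i^2 <= i] is enough. *)
have pt w : pos_sq n.+1 w <= pos_sq n w +
   2 * i * (Y w * incr n w) + i * (8 * M ^+ 2 * h + 4 * M ^+ 2).
  rewrite /pos_sq log_sumS; apply: le_trans (max0_sqr_step _ _) _; rewrite -/i.
  set t := Num.max (log_sum n w) 0; set z := incr n w.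
  have z2 : `|z| <= 2 * M := incr_bound n w.
  have tY : `|t - Y w| <= 2 * M * h.
    apply: le_trans (max0_dist _ _) _; apply: le_trans (log_sum_dist _ jn) _.
    by rewrite ler_wpM2l ?mulr_ge0.
  have tz : t * z <= Y w * z + 4 * M ^+ 2 * h.
    have : (t - Y w) * z <= 2 * M * h * (2 * M).
      by apply: le_trans (ler_norm _) _; rewrite normrM ler_pM.
    by lra.
  have zz : (z * i) ^+ 2 <= i * (4 * M ^+ 2).
    have -> : i * (4 * M ^+ 2) = (2 * M) ^+ 2 * i by ring.
    rewrite exprMn ler_pM ?sqr_ge0// ?expr2 ?ler_piMl//.
    by rewrite -!expr2 -[z ^+ 2]real_normK ?num_real// lerXn2r ?nnegrE ?mulr_ge0.
  have := ler_wpM2l i0 tz; move: zz; lra.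
have HV m : sl_H S (pos_sq m) by exact: BL_H (BL_pos_sq m).
have HYZ : sl_H S (fun w => Y w * incr n w).
  by apply/(BL_H HX)/(BL_mul _ (BL_incr n))/(BL_le (leq_trans jn (leqnSn n)) BY).
have HiYZ := sl_Hscale (2 * i) HYZ.
apply: (le_trans (sl_E_leD (HV n.+1) (sl_Hadd (HV n) HiYZ) pt)).
apply: (le_trans (lerD (sl_subadd (HV n) HiYZ) (lexx _))).
rewrite sl_poshom ?mulr_ge0//; have := ler_wpM2l i0 EYZ; rewrite -/i /h; lra.
Qed.

(** The same [r] serves every step up to [N], so the logarithmic factor stays constant and the
    weights [1/(n+1)] sum to [harm N <= 2 r]. *)
Lemma pos_sq_moment : exists2 K, 0 <= K & forall N r, (0 < r)%N ->
  harm N <= 2 * r%:R :> R -> E (pos_sq N) <= K * (1 + ln r%:R) * r%:R.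
Proof.
have M0 := bound_ge0.
have v0 : 0 <= v by apply: le_trans (EX2 0); apply: sl_E_ge => // w; exact: sqr_ge0.
have Q0 : 0 <= Q by have := eQ 0; rewrite harm0 mul0r.
pose K0 := 4 * M * Q + 8 * M * L * (1 + v / s) + 12 * M ^+ 2.
have K00 : 0 <= K0.
  by rewrite !addr_ge0 ?mulr_ge0 ?addr_ge0 ?divr_ge0 ?sqr_ge0// ltW.
have K10 : 0 <= 16 * M ^+ 2 by rewrite mulr_ge0 ?sqr_ge0.
exists (2 * (K0 + 16 * M ^+ 2)); first by rewrite mulr_ge0// addr_ge0.
move=> N r r0 hN; have lr : 0 <= ln r%:R :> R by rewrite ln_ge0// ler1n.
pose K := (K0 + 16 * M ^+ 2) * (1 + ln r%:R).
have K_ge0 : 0 <= K.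
  by apply: mulr_ge0; apply: addr_ge0.
have main n : (n <= N)%N -> E (pos_sq n) <= K * harm n.
  elim: n => [_|n IH nN].
    rewrite harm0 mulr0; apply: sl_E_le; first exact: BL_H (BL_pos_sq 0).
    by move=> w; rewrite /pos_sq /log_sum big_ord0 maxxx expr0n.
  have hn : harm n <= 2 * r%:R :> R by apply: le_trans hN; apply: le_harm; exact: ltnW.
  apply: le_trans (pos_sq_moment_step r0 hn) _.
  rewrite harmS [K * _]mulrDr lerD ?IH ?(ltnW nN)//.
  rewrite [K * _]mulrC ler_wpM2l ?invr_ge0// -/K0 /K.
  have := mulr_ge0 K00 lr; move: K00 K10; lra.
apply: le_trans (main N (leqnn N)) _; apply: le_trans (ler_wpM2l K_ge0 hN) _.
by rewrite /K; lra.
Qed.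

Lemma log_sum_upper : exists A : set T, [/\ measurable A,
  forall P, sl_P S P -> P A = 1%E &
  forall w, A w -> forall eps : R, 0 < eps ->
    \forall n \near \oo, log_sum n w <= eps * ln n%:R].
Proof.
pose V i w := pos_sq (sub_idx i) w / i.+1%:R ^+ 6.
have V0 i w : 0 <= V i w by rewrite divr_ge0 ?sqr_ge0// exprn_ge0.
have HV i : sl_H S (V i).
  by apply/(BL_H HX)/(BL_mul (BL_pos_sq (sub_idx i))); exact: BL_cst.
have mV i : measurable_fun setT (V i) by exact: sl_Hmeas (HV i).
have [K K0 HK] := pos_sq_moment.
(* With [r = (i+1)^3], the bound [1 + ln r <= 3 (i+1)] leaves [(i+1)^4 / (i+1)^6]. *)
have EV i : E (V i) <= 3 * K * (i.+1%:R ^+ 2)^-1.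
  have i0 : 0 < i.+1%:R :> R by [].
  have -> : V i = (fun w => (i.+1%:R ^+ 6)^-1 * pos_sq (sub_idx i) w).
    by apply/funext => w; rewrite /V mulrC.
  rewrite sl_poshom ?invr_ge0 ?exprn_ge0//; last exact: BL_H (BL_pos_sq _).
  have r0 : (0 < i.+1 ^ 3)%N by rewrite expn_gt0.
  have := HK _ _ r0 (harm_sub_idx i); have := @ln_cube R i.
  move=> /(ler_wpM2l K0) /(ler_wpM2r (ler0n R (i.+1 ^ 3))) h1 h2.
  have := le_trans h2 h1; rewrite natrX => h.
  rewrite mulrC ler_pdivrMr ?exprn_gt0//; apply: le_trans h _.
  rewrite le_eqVlt; apply/orP; left; apply/eqP; field.
  by rewrite gt_eqF.
(* This set is defined without reference to a measure, so one set serves every [P]. *)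
exists (summable_set V); split.
- exact: measurable_summable_set.
- move=> P SP; apply: (@probability_summable_set _ _ _ V V0 mV P
    (fun i => 3 * K * (i.+1%:R ^+ 2)^-1) (3 * K * 2)).
    move=> i; apply: (@le_trans _ _ (E (V i))%:E); last by rewrite lee_fin.
    have [_ ->] := sl_repr (HV i); apply: ereal_sup_ubound.
    by exists P.
  by move=> n; rewrite -mulr_sumr ler_wpM2l ?mulr_ge0// sum_inv_sq.
- move=> w /(summable_set_cvg0 V0) Vw.
  apply: (@log_sum_little _ (log_sum ^~ w) (2 * M)) => //.
    by rewrite mulr_ge0// bound_ge0.
  by move=> j n jn; exact: log_sum_dist.
Qed.

End SecondMoment.

(** * A countable family of Lipschitz majorants *)

Section CountableMajorants.
Context {R : realType}.
Implicit Types (M L : nat) (s : seq (rat * rat)) (x y : R).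

(* With rational [p_i], [q_i] and integral [M], [L] these are countably many, yet
   every bounded Lipschitz function is approximated from above by them. *)
Definition cone_min M L s x : R :=
  foldr (fun p acc => Num.min (ratr p.2 + L%:R * `|x - ratr p.1|) acc) M%:R s.

Lemma min_lip (a b a' b' e : R) :
  `|a - a'| <= e -> `|b - b'| <= e -> `|Num.min a b - Num.min a' b'| <= e.
Proof.
rewrite !ler_norml /Num.min => /andP[? ?] /andP[? ?].
by case: ltP => ?; case: ltP => ?; apply/andP; split; lra.
Qed.

Lemma bdd_lip1_cone_min M L s : bdd_lip1 (cone_min M L s).
Proof.
suff [B [HB HL]] : exists B, (forall x, `|cone_min M L s x| <= B) /\
    forall x y, `|cone_min M L s x - cone_min M L s y| <= L%:R * `|x - y|.
  by split; [exists B|exists L%:R].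
elim: s => [|[p q] s [B [HB HL]]] /=.
  exists M%:R; split => [x|x y]; first by rewrite ger0_norm.
  by rewrite subrr normr0 mulr_ge0.
exists (`|ratr q| + B); split => [x|x y]; last first.
  apply: min_lip => //; rewrite opprD addrACA subrr add0r -mulrBr normrM ger0_norm//.
  rewrite ler_wpM2l//; apply: le_trans (ler_dist_dist _ _) _.
  by rewrite opprB addrACA addrA addrK.
have := HB x; have : 0 <= L%:R * `|x - ratr p| by rewrite mulr_ge0.
have := ler_norm (ratr q : R); have := ler_norm (- ratr q : R); rewrite normrN.
by rewrite !ler_norml /Num.min; case: ltP => ? ? ? ? /andP[? ?]; apply/andP; split; lra.
Qed.

Lemma cone_min_le M L s x : cone_min M L s x <= M%:R.
Proof. by elim: s => //= p s IH; rewrite ge_min IH orbT. Qed.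

Lemma cone_min_le_at M L s x p : p \in s ->
  cone_min M L s x <= ratr p.2 + L%:R * `|x - ratr p.1|.
Proof.
elim: s => //= p' s IH; rewrite inE => /orP[/eqP <-|/IH h].
  by rewrite ge_min lexx.
by rewrite ge_min h orbT.
Qed.

Lemma le_cone_min M L s x y : y <= M%:R ->
  (forall p, p \in s -> y <= ratr p.2 + L%:R * `|x - ratr p.1|) ->
  y <= cone_min M L s x.
Proof.
move=> yM; elim: s => //= p s IH h; rewrite le_min h ?inE ?eqxx//=.
by apply: IH => p' p's; apply: h; rewrite inE p's orbT.
Qed.

(** Cones of slope [L] stand on a grid in [[-N, N]], with rational heights just above [f]. The
    Lipschitz bound keeps each cone above [f] everywhere, and a nearby grid point gives closeness on
    the interval. *)
Lemma cone_min_approx M L (N : nat) (f : R -> R) (eta : R) :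
  (forall x, `|f x| <= M%:R) -> (forall x y, `|f x - f y| <= L%:R * `|x - y|) ->
  0 < eta -> exists s, forall x, f x <= cone_min M L s x /\
    (`|x| <= N%:R -> cone_min M L s x <= f x + eta).
Proof.
move=> fM fL eta0; have e2 : 0 < eta / 2 by rewrite divr_gt0.
(* The mesh [1/K] satisfies [L / K <= eta / 4], which is spent once on the cone and once on [f]; the
   height takes the remaining [eta / 2]. *)
have [K K0 HK] : exists2 K : nat, (0 < K)%N & 2 * L%:R / (eta / 2) <= K%:R.
  by exists (Num.truncn (2 * L%:R / (eta / 2))).+1 => //; exact/ltW/truncnS_gt.
have K0' : 0 < K%:R :> R by rewrite ltr0n.
have exq (p : rat) : exists q : rat, f (ratr p) <= ratr q <= f (ratr p) + eta / 2.
  have : f (ratr p) < f (ratr p) + eta / 2 by rewrite ltrDl.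
  move=> /rat_in_itvoo[q]; rewrite in_itv/= => /andP[? ?].
  by exists q; rewrite !ltW.
have [Q HQ] := choice exq.
pose P i : rat := i%:R / K%:R - N%:R.
pose s := [seq (P i, Q (P i)) | i <- iota 0 (2 * N * K).+1].
exists s => x; split.
  apply: le_cone_min; first exact: le_trans (ler_norm _) (fM x).
  move=> _ /mapP[i _ ->]/=; have /andP[h _] := HQ (P i).
  have := fL x (ratr (P i)); rewrite ler_distl => /andP[_]; lra.
move=> xN; pose y := (x + N%:R) * K%:R.
have y0 : 0 <= y by rewrite mulr_ge0//; move: xN; rewrite ler_norml; lra.
pose i := Num.truncn y.
have /andP[iy yi] := truncn_itv y0.
have Pi : ratr (P i) = i%:R / K%:R - N%:R :> R.
  by rewrite /P rmorphB/= fmorph_div/= !ratr_nat.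
have is_ : (P i, Q (P i)) \in s.
  apply/mapP; exists i => //; rewrite mem_iota/= add0n ltnS.
  rewrite -(ler_nat R); apply: le_trans iy _; rewrite /y natrM ler_pM2r// natrM.
  by move: xN; rewrite ler_norml; lra.
apply: le_trans (cone_min_le_at _ _ _ is_) _ => /=.
have /andP[_ h] := HQ (P i).
have hx : `|x - ratr (P i)| <= K%:R^-1.
  have -> : x - ratr (P i) = (y - i%:R) / K%:R.
    by rewrite Pi /y; field; rewrite gt_eqF.
  rewrite normrM normfV (gtr0_norm K0') ler_piMl ?invr_ge0 ?(ltW K0')//.
  rewrite ger0_norm ?subr_ge0// lerBlDr.
  by move: yi; rewrite -natr1 -/i addrC; exact: ltW.
have hL : L%:R * `|x - ratr (P i)| <= eta / 4.
  apply: le_trans (ler_wpM2l (ler0n R L) hx) _; rewrite ler_pdivrMr//.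
  by move: HK; rewrite ler_pdivrMr//; lra.
have := fL x (ratr (P i)); rewrite ler_distl => /andP[+ _]; lra.
Qed.

End CountableMajorants.

(** * Logarithmic averages *)

Section LogarithmicAverage.
Context {R : realType}.

Definition log_avg (a : nat -> R) (n : nat) : R :=
  (ln n%:R)^-1 * \sum_(1 <= k < n.+1) k%:R^-1 * a k.

Lemma ln_nat_ge0 n : 0 <= ln n%:R :> R.
Proof. by case: n => [|n]; [rewrite ln0|rewrite ln_ge0// ler1n]. Qed.

Lemma le_log_avg (a a' : nat -> R) n : (forall k, a k <= a' k) ->
  log_avg a n <= log_avg a' n.
Proof.
move=> aa'; rewrite ler_wpM2l ?invr_ge0 ?ln_nat_ge0//.
by apply: ler_sum => k _; rewrite ler_wpM2l ?invr_ge0.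
Qed.

Lemma log_avgN (a : nat -> R) n : log_avg (fun k => - a k) n = - log_avg a n.
Proof.
rewrite /log_avg -mulrN -sumrN; congr (_ * _).
by apply: eq_bigr => k _; rewrite mulrN.
Qed.

Lemma ln_nat_unbounded (A : R) : \forall n \near \oo, A <= ln n%:R.
Proof.
exists (Num.truncn (expR A)).+1 => // n /= nA.
have e0 := expR_gt0 A.
have h : expR A <= n%:R by apply: ltW; apply: lt_le_trans (truncnS_gt _) _; rewrite ler_nat.
by rewrite -[A]expRK ler_ln// posrE; exact: lt_le_trans h.
Qed.

(** Centering contributes [c harm n] instead of [c ln n]; since [harm n - ln n] lies in [[0, 1]],
    the error vanishes after division by [ln n]. *)
Lemma log_avg_upper (a : nat -> R) (c : R) :
  (forall eps, 0 < eps -> \forall n \near \oo,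
     \sum_(k < n) (a k.+1 - c) / k.+1%:R <= eps * ln n%:R) ->
  forall eps : R, 0 < eps -> \forall n \near \oo, log_avg a n <= c + eps.
Proof.
move=> ha eps eps0; have e2 : 0 < eps / 2 by rewrite divr_gt0.
have h1 := ha _ e2; have h2 := ln_nat_unbounded (`|c| / (eps / 2)).
have h3 := ln_nat_unbounded 1.
near=> n.
have n0 : (0 < n)%N by near: n; exists 1%N.
have l1 : 1 <= ln n%:R :> R by near: n.
have l0 : 0 < ln n%:R :> R by apply: lt_le_trans l1.
have hs : \sum_(k < n) (a k.+1 - c) / k.+1%:R <= eps / 2 * ln n%:R by near: n.
have hc : `|c| / (eps / 2) <= ln n%:R by near: n.
rewrite ler_pdivrMr// mulrC in hc.
have E : \sum_(1 <= k < n.+1) k%:R^-1 * a k =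
    \sum_(k < n) (a k.+1 - c) / k.+1%:R + c * harm n.
  rewrite big_add1 big_mkord /harm mulr_sumr -big_split/=.
  by apply: eq_bigr => k _; ring.
rewrite /log_avg E mulrC ler_pdivrMr//.
have hh : c * harm n <= c * ln n%:R + `|c|.
  rewrite -lerBlDl -mulrBr; apply: le_trans (ler_norm _) _; rewrite normrM.
  have u := @harm_le_ln R n n0; have l := @ln_le_harm R n n0.
  by rewrite ler_piMr// ger0_norm ?subr_ge0//; lra.
lra.
Unshelve. all: by end_near.
Qed.

End LogarithmicAverage.

(** * The rate in Song's theorem for the given sequence *)

Section SongRate.
Context {R : realType} {d : measure_display} {T : measurableType d}.
Variables (S : sublinear_space R T) (beta alpha : R) (X : nat -> T -> R).
Hypotheses (beta1 : 1 <= beta) (gX : good_seq S beta alpha X).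
Hypothesis alpha0 : 0 < alpha.
Local Notation E := (sl_E S).

Lemma sigma_mid_bounds : exists s u : R, [/\ 0 < s, 0 < u,
  forall i, s <= sigma_mid S (X i) ^+ 2,
  forall i, 0 < sigma_mid S (X i) <= u &
  forall i, E (fun w => X i w ^+ 2) <= u ^+ 2].
Proof.
have [HX _ _ bX [[s [s0 lows]] [C upC]]] := gX.
have low0 i : 0 < sigma_low S (X i).
  rewrite lt_neqAle sqrtr_ge0 andbT eq_sym; apply/eqP => h.
  by have := lt_le_trans s0 (lows i); rewrite h expr0n ltxx.
have upE i : sigma_up S (X i) = beta * sigma_low S (X i).
  by rewrite -(bX i) divfK// gt_eqF.
have lowup i : sigma_low S (X i) <= sigma_up S (X i).
  by rewrite upE ler_peMl// ltW.
have up_le i : sigma_up S (X i) <= `|C| + 1.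
  have up0 : 0 <= sigma_up S (X i) by exact: sqrtr_ge0.
  have := upC i; have := ler_norm C; nra.
have C1 : 0 < `|C| + 1 by rewrite ltr_wpDl.
exists s, (`|C| + 1); split => // i.
- apply: le_trans (lows i) _.
  have lm : sigma_low S (X i) <= sigma_mid S (X i).
    by rewrite /sigma_mid; have := lowup i; lra.
  by rewrite ler_sqr ?nnegrE ?(ltW (low0 i))// (le_trans (ltW (low0 i))).
- rewrite /sigma_mid; have := low0 i; have := lowup i; have := up_le i; lra.
- have [_ [HX2 _]] := HX i.
  rewrite -[leLHS]sqr_sqrtr; last by apply: sl_E_ge => // w; exact: sqr_ge0.
  by rewrite lerXn2r ?nnegrE ?sqrtr_ge0 ?(ltW C1)//; exact: up_le.
Qed.

Lemma Bn_sqr_ge (s : R) : (forall i, s <= sigma_mid S (X i) ^+ 2) ->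
  forall n, s * n%:R <= Bn S X n ^+ 2.
Proof.
move=> hs n; rewrite /Bn sqr_sqrtr; last by apply: sumr_ge0 => i _; exact: sqr_ge0.
by rewrite mulr_natr -[in leLHS](card_ord n) -sumr_const ler_sum.
Qed.

(** The [sigma_mid] are bounded above and away from 0, and [Bn] is at least of order [sqrt n], so
    the rate is [O(n^(- alpha / 2))]. *)
Lemma song_rate (Mm : R) : (forall i, E (fun w => `|X i w| `^ (2 + alpha)) <= Mm) ->
  exists2 K : R, 0 <= K & forall n, (0 < n)%N ->
    \big[Num.max/0]_(i < n)
      (E (fun w => `|X i w| `^ (2 + alpha)) / sigma_mid S (X i) `^ (2 + alpha)
         * (sigma_mid S (X i) / Bn S X n) `^ alpha)
    <= K * ((Num.sqrt n%:R) `^ alpha)^-1.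
Proof.
move=> hM; have [s [u [s0 u0 hs hu _]]] := sigma_mid_bounds.
have [HX _ _ _ _] := gX.
have r0 : 0 < Num.sqrt s by rewrite sqrtr_gt0.
have Em0 i : 0 <= E (fun w => `|X i w| `^ (2 + alpha)).
  by have [_ [_ H]] := HX i; apply: sl_E_ge => // w; exact: powR_ge0.
have Mm0 : 0 <= Mm := le_trans (Em0 0) (hM 0).
exists (Mm / Num.sqrt s `^ (2 + alpha) * (u / Num.sqrt s) `^ alpha).
  by rewrite mulr_ge0 ?divr_ge0 ?powR_ge0.
move=> n n0; have n0' : 0 < n%:R :> R by rewrite ltr0n.
have z0 : 0 < Num.sqrt n%:R :> R by rewrite sqrtr_gt0.
have Bz : Num.sqrt s * Num.sqrt n%:R <= Bn S X n.
  rewrite -sqrtrM ?(ltW s0)// -[leRHS]ger0_norm ?sqrtr_ge0// -sqrtr_sqr.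
  by rewrite ler_wsqrtr// Bn_sqr_ge.
have B0 : 0 < Bn S X n by apply: lt_le_trans Bz; rewrite mulr_gt0.
apply: bigmax_le => [|i _].
  by rewrite !mulr_ge0 ?divr_ge0 ?invr_ge0 ?powR_ge0.
have /andP[m0 mu] := hu i.
have sm : Num.sqrt s <= sigma_mid S (X i).
  by rewrite -[leRHS]ger0_norm ?(ltW m0)// -sqrtr_sqr ler_wsqrtr.
rewrite -[leRHS]mulrA; apply: ler_pM.
- by rewrite divr_ge0 ?powR_ge0.
- exact: powR_ge0.
- apply: ler_pM => //; first by rewrite invr_ge0 powR_ge0.
  rewrite lef_pV2 ?posrE ?powR_gt0// ge0_ler_powR ?nnegrE ?(ltW r0) ?(ltW m0)//.
  by rewrite addr_ge0// ltW.
- have -> : (Num.sqrt n%:R `^ alpha)^-1 = (Num.sqrt n%:R)^-1 `^ alpha.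
    by rewrite -powRN -[X in _ = X `^ _]powR_inv1 ?(ltW z0)// -powRrM mulN1r.
  have a1 : 0 <= u / Num.sqrt s by rewrite divr_ge0 ?ltW.
  have a2 : 0 <= (Num.sqrt n%:R)^-1 :> R by rewrite invr_ge0 ltW.
  have a3 : 0 <= sigma_mid S (X i) / Bn S X n by rewrite divr_ge0 ?ltW.
  have h : sigma_mid S (X i) / Bn S X n <= u / Num.sqrt s * (Num.sqrt n%:R)^-1.
    rewrite -mulrA -invfM; apply: ler_pM; rewrite ?invr_ge0 ?(ltW m0) ?(ltW B0)//.
    by rewrite lef_pV2 ?posrE// mulr_gt0.
  by rewrite -powRM//; apply: ge0_ler_powR => //; [exact: ltW|exact: mulr_ge0].
Qed.

Lemma harm_rate n :
  harm n * ((Num.sqrt n.+1%:R) `^ alpha)^-1 <= 1 + 2 / alpha.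
Proof.
set y := n.+1%:R : R; have y1 : 1 <= y by rewrite ler1n.
have y0 : 0 < y := lt_le_trans ltr01 y1.
have z1 : 1 <= Num.sqrt y by rewrite -sqrtr1 ler_wsqrtr.
have z0 : 0 < Num.sqrt y := lt_le_trans ltr01 z1.
set p := Num.sqrt y `^ alpha.
have p0 : 0 < p by rewrite powR_gt0.
have p1 : 1 <= p by rewrite -(powRr0 (Num.sqrt y)) ler_powR// ltW.
(* With [p = y^(alpha/2)], the inequality [ln p < p] makes the logarithm at most [(2 / alpha) p]. *)
have lny : ln y = 2 / alpha * ln p.
  rewrite ln_powR -[y in LHS](sqr_sqrtr (ltW y0)) lnXn// -[_ *+ 2]mulr_natl.
  by field; rewrite gt_eqF.
rewrite ler_pdivrMr//.
apply: le_trans (le_harm (leqnSn n)) _; apply: le_trans (harm_le_ln (ltn0Sn n)) _.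
rewrite -/y lny; have h := ln_sublinear p0.
have a0 : 0 <= 2 / alpha by rewrite divr_ge0// ltW.
by have := ler_wpM2l a0 (ltW h); move: (2 / alpha) => q; lra.
Qed.

End SongRate.

(** * Events of full probability and the upper bound for one test function *)

Lemma probability_bigcap1 {R : realType} {d : measure_display} {T : measurableType d}
  (P : probability T R) (F : nat -> set T) : (forall n, measurable (F n)) ->
  (forall n, P (F n) = 1%E) -> P (\bigcap_n F n) = 1%E.
Proof.
move=> mF PF; have mC : measurable (~` \bigcap_n F n).
  by apply: measurableC; exact: bigcapT_measurable.
have PC0 : P (~` \bigcap_n F n) = 0%E.
  apply/negligibleP => //; rewrite setC_bigcap; apply: negligible_bigcup => n.
  apply/negligibleP; first exact: measurableC.
  by apply: etrans (probability_setC P (mF n)) _; rewrite PF subee.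
by have := probability_setC P mC; rewrite setCK PC0 sube0.
Qed.

(** The supremum over an empty family would be [-oo], whereas the expectation is real. Nonemptiness
    ensures that the infimum defining [lower_cap] is not [+oo]. *)
Lemma sl_P_nonempty {R : realType} {d : measure_display} {T : measurableType d}
  (S : sublinear_space R T) : exists P, sl_P S P.
Proof.
apply: contrapT => noP; have [_] := sl_repr (sl_Hcst S 0).
rewrite (_ : sl_P S = set0) ?image_set0 ?ereal_sup0//.
by apply/seteqP; split => // P SP; case: noP; exists P.
Qed.

Lemma log_avg_limsup (R : realType)
  (d : measure_display) (T : measurableType d) (S : sublinear_space R T)
  (d2 : measure_display) (T2 : measurableType d2) (S2 : sublinear_space R T2)
  (beta alpha : R) (X : nat -> T -> R) (xi : T2 -> R) (C Mm : R) :
  1 <= beta -> good_seq S beta alpha X -> sl_H S2 xi -> 0 < alpha -> 0 < C ->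
  (forall n : nat, (1 <= n)%N ->
     forall f : R -> R, bdd_lip1 f -> (forall x y, `|f x - f y| <= `|x - y|) ->
       `|sl_E S (fun w => f (Wn S X n w)) - sl_E S2 (fun w => f (xi w))| <=
       C * \big[Num.max/0]_(i < n)
             (sl_E S (fun w => `|X i w| `^ (2 + alpha))
                / sigma_mid S (X i) `^ (2 + alpha)
              * (sigma_mid S (X i) / Bn S X n) `^ alpha)) ->
  (forall i, sl_E S (fun w => `|X i w| `^ (2 + alpha)) <= Mm) ->
  forall f : R -> R, bdd_lip1 f -> exists A : set T, [/\ measurable A,
    forall P, sl_P S P -> P A = 1%E &
    forall w, A w -> forall eps : R, 0 < eps -> \forall n \near \oo,
      log_avg (fun k => f (Wn S X k w)) n <= sl_E S2 (fun w' => f (xi w')) + eps].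
Proof.
move=> beta1 gX Hxi alpha0 C0 song hMm f bf.
(* Adding 1 makes the Lipschitz constant positive, so that dividing by it is possible. *)
have [[M fM] [L' fL']] := bf; pose L := L' + 1.
have L0 : 0 < L by have := lip1_ge0 fL'; rewrite /L; lra.
have fL x y : `|f x - f y| <= L * `|x - y|.
  by apply: le_trans (fL' x y) _; rewrite ler_wpM2r// /L; lra.
have [s [u [s0 u0 hs hu hX2]]] := sigma_mid_bounds beta1 gX.
have [K K0 hK] := song_rate beta1 gX alpha0 hMm.
have [HXs indX EX _ _] := gX.
have HX i : sl_H S (X i) by have [] := HXs i.
have HX2 i : sl_H S (fun w => X i w ^+ 2) by have [_ []] := HXs i.
have Hf2 := sl_H_comp1 Hxi bf.
pose c := sl_E S2 (fun w => f (xi w)).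
have cM : `|c| <= M by exact: sl_E_norm.
have bs n : s * n.+1%:R <= Bn S X n.+1 ^+ 2 by exact: Bn_sqr_ge.
have b0 n : 0 < Bn S X n.+1.
  rewrite lt_neqAle sqrtr_ge0 andbT eq_sym; apply/eqP => h.
  by have := bs n; rewrite h expr0n/= leNgt mulr_gt0.
pose e n := L * (C * (K * (Num.sqrt n.+1%:R `^ alpha)^-1)).
have e0 n : 0 <= e n.
  by rewrite !mulr_ge0 ?invr_ge0 ?powR_ge0// ltW.
have Efe n : sl_E S (fun w => f (block_sum X 0 n.+1 w / Bn S X n.+1)) <= c + e n.
  (* Song's theorem concerns 1-Lipschitz functions, so it is applied to [f / L]. *)
  pose g x := L^-1 * f x.
  have iL0 : 0 <= L^-1 by rewrite invr_ge0 ltW.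
  have gL x y : `|g x - g y| <= `|x - y|.
    by rewrite -mulrBr normrM ger0_norm// mulrC ler_pdivrMr// mulrC.
  have bg : bdd_lip1 g.
    split; last by exists 1 => x y; rewrite mul1r.
    by exists (L^-1 * M) => x; rewrite normrM ger0_norm// ler_wpM2l.
  have := song n.+1 isT g bg gL.
  have HfW : sl_H S (fun w => f (Wn S X n.+1 w)).
    apply: (BL_H HX (n := n.+1)).
    exact: (BL_block_sum X 0 n.+1 (bdd_lip1_scale (Bn S X n.+1) bf)).
  rewrite !sl_poshom// -/c => h.
  have := le_trans h (ler_wpM2l (ltW C0) (hK n.+1 isT)).
  rewrite -mulrBr normrM ger0_norm// mulrC ler_pdivrMr// => {}h.
  have := le_trans (ler_norm _) h; rewrite -/(Wn S X n.+1) lerBlDl [_ * L]mulrC.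
  exact.
have eQ n : harm n * e n <= L * C * K * (1 + 2 / alpha).
  have -> : harm n * e n = L * C * K * (harm n * (Num.sqrt n.+1%:R `^ alpha)^-1).
    by rewrite /e; ring.
  by rewrite ler_wpM2l ?harm_rate// !mulr_ge0 ?(ltW L0) ?(ltW C0).
have [A [mA PA Aw]] :=
  log_sum_upper HX HX2 indX EX hX2 s0 b0 bs fM cM L0 fL e0 Efe eQ.
exists A; split => // w /Aw hw; exact: log_avg_upper hw.
Qed.

(** * The almost sure central limit theorem, for all of [calH] at once *)

Theorem theorem4p2 (R : realType)
  (d : measure_display) (T : measurableType d) (S : sublinear_space R T)
  (d2 : measure_display) (T2 : measurableType d2) (S2 : sublinear_space R T2)
  (beta alpha : R) (X : nat -> T -> R) (xi : T2 -> R) :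
  1 <= beta ->
  (* the standing assumptions on {X_i} (X 0 is X_1) *)
  good_seq S beta alpha X ->
  (* condition (A) for both spaces *)
  condA S -> condA S2 ->
  (* xi is G-normal under E~ with the prescribed upper/lower variances *)
  G_normal S2 xi ->
  Num.sqrt (sl_E S2 (fun w => xi w ^+ 2)) = 2 * beta / (1 + beta) ->
  Num.sqrt (- sl_E S2 (fun w => - xi w ^+ 2)) = 2 / (1 + beta) ->
  (* alpha is a constant for which Song's theorem holds *)
  0 < alpha < 1 ->
  (exists C : R, 0 < C /\
     forall Y : nat -> T -> R, good_seq S beta alpha Y ->
     forall n : nat, (1 <= n)%N ->
     forall f : R -> R, bdd_lip1 f -> (forall x y, `|f x - f y| <= `|x - y|) ->
       `|sl_E S (fun w => f (Wn S Y n w)) - sl_E S2 (fun w => f (xi w))| <=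
       C * \big[Num.max/0]_(i < n)
             (sl_E S (fun w => `|Y i w| `^ (2 + alpha))
                / sigma_mid S (Y i) `^ (2 + alpha)
              * (sigma_mid S (Y i) / Bn S Y n) `^ alpha)) ->
  (* sup_i E[|X_i|^{2+alpha}] < oo *)
  (exists M : R, forall i, sl_E S (fun w => `|X i w| `^ (2 + alpha)) <= M) ->
  (* nu( lim (1/log n) sum_{k<=n} f(W_k)/k = E~[f(xi)] for all f in calH ) = 1 *)
  exists A : set T, measurable A /\
    (A `<=` [set w | forall f : R -> R, calH S2 xi f ->
       (fun n : nat => (ln n%:R)^-1 *
          \sum_(1 <= k < n.+1) k%:R^-1 * f (Wn S X k w))
         @ \oo --> sl_E S2 (fun w' => f (xi w'))]) /\
    lower_cap S A = 1%E.
Proof.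
move=> beta1 gX _ _ [Hxi [Hxi2 _]] _ _ /andP[alpha0 _] [C [C0 song]] [Mm hMm].
(* An enumeration of all the cone minima; a number that codes no triple is sent to the zero
   function. *)
pose g (n : nat) : R -> R :=
  if @unpickle (nat * nat * seq (rat * rat))%type n is Some (M, L, s)
  then cone_min M L s else fun=> 0.
have bg n : bdd_lip1 (g n).
  rewrite /g; case: unpickle => [[[M L] s]|]; first exact: bdd_lip1_cone_min.
  split; first by exists 0 => x; rewrite normr0.
  by exists 0 => x y; rewrite subrr normr0 mul0r.
have [F HF] := choice (fun n =>
  log_avg_limsup beta1 gX Hxi alpha0 C0 (song X gX) hMm (bg n)).
have mF n : measurable (F n) by have [] := HF n.
pose v2 := sl_E S2 (fun w => xi w ^+ 2).
have v20 : 0 <= v2 by apply: sl_E_ge => // w; exact: sqr_ge0.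
have upper w f (eps : R) : (\bigcap_n F n) w -> bdd_lip1 f -> 0 < eps ->
    \forall n \near \oo, log_avg (fun k => f (Wn S X k w)) n <=
      sl_E S2 (fun w' => f (xi w')) + eps.
  move=> Fw bf eps0; have [[M0 fM0] [L0 fL0]] := bf.
  pose M := (Num.truncn M0).+1; pose L := (Num.truncn L0).+1.
  have fM x : `|f x| <= M%:R by apply: le_trans (fM0 x) _; exact/ltW/truncnS_gt.
  have fL x y : `|f x - f y| <= L%:R * `|x - y|.
    by apply: le_trans (fL0 x y) _; rewrite ler_wpM2r//; exact/ltW/truncnS_gt.
  have e4 : 0 < eps / 4 by rewrite divr_gt0.
  (* Large enough for [2 M v2 / N^2 <= eps / 4], the tail term of the next estimate. *)
  pose N := (Num.truncn (2 * M%:R * v2 / (eps / 4))).+1.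
  have HN : 2 * M%:R * v2 / (eps / 4) <= N%:R by exact/ltW/truncnS_gt.
  have N1 : 1 <= N%:R :> R by rewrite ler1n.
  have N0 : 0 < N%:R :> R by rewrite ltr0n.
  have [s Hs] := cone_min_approx N fM fL e4.
  have bh := bdd_lip1_cone_min (R := R) M L s.
  (* A pointwise Chebyshev bound: outside [[-N, N]] the majorant exceeds [f] by at most [2 M], hence
     by at most [2 M x^2 / N^2], which the second moment of [xi] controls. *)
  have hle x : cone_min M L s x <= f x + 2 * M%:R / N%:R ^+ 2 * x ^+ 2 + eps / 4.
    have [_ h] := Hs x; have [/h h'|xN] := leP `|x| N%:R.
      have : 0 <= 2 * M%:R / N%:R ^+ 2 * x ^+ 2.
        by rewrite mulr_ge0 ?sqr_ge0// divr_ge0// exprn_ge0.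
      by lra.
    have q1 : 1 <= x ^+ 2 / N%:R ^+ 2.
      rewrite ler_pdivlMr ?exprn_gt0// mul1r -[x ^+ 2]real_normK ?num_real//.
      by rewrite ler_sqr ?nnegrE ?(ltW N0) ?(ltW xN).
    have := cone_min_le M L s x; have := fM x; rewrite ler_norml => /andP[fMx _].
    have : 2 * M%:R <= 2 * M%:R / N%:R ^+ 2 * x ^+ 2.
      rewrite -mulrA [_^-1 * _]mulrC ler_peMr// mulr_ge0//.
    by lra.
  have Hh := sl_H_comp1 Hxi bh; have Hf := sl_H_comp1 Hxi bf.
  have Eh : sl_E S2 (fun w' => cone_min M L s (xi w')) <=
      sl_E S2 (fun w' => f (xi w')) + eps / 2.
    have HN2 := sl_Hscale (2 * M%:R / N%:R ^+ 2) Hxi2.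
    apply: le_trans (sl_E_leD Hh (sl_Hadd Hf HN2) (fun w' => hle (xi w'))) _.
    apply: le_trans (lerD (sl_subadd Hf HN2) (lexx _)) _.
    rewrite sl_poshom ?divr_ge0 ?exprn_ge0 ?mulr_ge0// -/v2 -addrA lerD2l.
    have : 2 * M%:R / N%:R ^+ 2 * v2 <= eps / 4.
      rewrite mulrAC ler_pdivrMr ?exprn_gt0//.
      move: HN; rewrite ler_pdivrMr// => /le_trans; apply.
      by rewrite mulrC ler_pM2l// expr2 ler_peMr// ltW.
    by lra.
  have e2 : 0 < eps / 2 by rewrite divr_gt0.
  have [_ _ /(_ w (Fw (pickle (M, L, s)) I) _ e2)] := HF (pickle (M, L, s)).
  rewrite /g pickleK; apply: filterS => n hn.
  apply: (@le_trans _ _ (log_avg (fun k => cone_min M L s (Wn S X k w)) n)).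
    by apply: le_log_avg => k; have [] := Hs (Wn S X k w).
  by apply: le_trans hn _; lra.
exists (\bigcap_n F n); split; first exact: bigcapT_measurable.
split.
  move=> w Fw f [bf fH]; apply/cvgrPdist_le => eps eps0.
  (* Membership in [calH] turns the upper bound for [- f] into the matching lower bound for [f]. *)
  have bNf : bdd_lip1 (fun x => - f x).
    have [[M fM] [L fL]] := bf; split; first by exists M => x; rewrite normrN.
    by exists L => x y; rewrite -opprD normrN.
  have h1 := upper w f eps Fw bf eps0; have h2 := upper w _ eps Fw bNf eps0.
  near=> n.
  have u1 : log_avg (fun k => f (Wn S X k w)) n <=
      sl_E S2 (fun w' => f (xi w')) + eps by near: n.
  have u2 : log_avg (fun k => - f (Wn S X k w)) n <=
      sl_E S2 (fun w' => - f (xi w')) + eps by near: n.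
  rewrite log_avgN in u2; rewrite distrC ler_distl -/(log_avg _ n).
  by move: u1 u2 fH; rewrite /log_avg; lra.
have [P0 SP0] := sl_P_nonempty S.
have PF P : sl_P S P -> P (\bigcap_n F n) = 1%E.
  by move=> SP; apply: probability_bigcap1 => // n; have [_ /(_ P SP)] := HF n.
rewrite /lower_cap (_ : [set _ | _ in _] = [set 1%E]) ?ereal_inf1//.
apply/seteqP; split => [_ [P SP <-]|_ ->]; first exact: PF.
by exists P0 => //; exact: PF.
Unshelve. all: by end_near.
Qed.
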